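(* For any $\delta\in(0,1]$, $p\in(0,1/2]$, $\varepsilon\in(0,p)$, $K,M\geq 1$ there are $n_1=n_1(\delta,\varepsilon,p,K,M)\geq 1$ and $\eta=\eta(\delta,\varepsilon,p,K,M)\in(0,1]$ depending on $\delta,\varepsilon,p,K,M$, and $L=L(\delta,\varepsilon,p,K)>0$ depending only on $\delta,\varepsilon,p,K$ (and not on $M$), with the following property. Let $n\geq n_1$, let $N$ be an integer with $1\leq N\leq (1-p+\varepsilon)^{-n}$, let $\mathcal A$ be an $(N,n,K,\delta)$-admissible set, and let $f:\mathbb{Z}\to[0,\infty)$ be a function with $\|f\|_1=\sum_{t\in\mathbb{Z}}f(t)=1$ such that $\log_2 f$ is $\eta$-Lipschitz. Then $$\mathbb{P}\big\{\|f_{\mathcal A,p,n}\|_\infty> L\,(N\sqrt{n})^{-1}\big\}\leq \exp(-Mn).$$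
   Context: A map $g:\mathbb{Z}\to\mathbb{R}$ is $L$-Lipschitz if $|g(t)-g(t+1)|\leq L$ for all $t\in\mathbb{Z}$. For integers $N,n\geq1$ and reals $\delta\in(0,1]$, $K\geq1$, a set $\mathcal A\subset\mathbb{Z}^n$ is $(N,n,K,\delta)$-admissible if: $\mathcal A=A_1\times\dots\times A_n$ with each $A_i$ an origin-symmetric subset of $\mathbb{Z}$; $A_i$ is an integer interval of cardinality at least $2N+1$ for every $i>\delta n$; for every $i\leq\delta n$, $A_i$ is a union of two integer intervals of total cardinality at least $2N$ and $A_i\cap[-N,N]=\emptyset$; $|A_1|\cdots|A_n|\leq (KN)^n$; and $\max A_i<nN$ for all $i$. Given such $\mathcal A$, $p\in(0,1)$ and $f:\mathbb{Z}\to\mathbb{R}$, let $X_1,\dots,X_n$ be independent with $X_i$ uniform on $A_i$, and for $\ell\leq n$ define the random function $$f_{\mathcal A,p,\ell}(t)=\sum_{(v_j)_{j=1}^\ell\in\{0,1\}^\ell}p^{\sum_j v_j}(1-p)^{\ell-\sum_j v_j} f(t+v_1X_1+\dots+v_\ell X_\ell),\quad t\in\mathbb{Z}.$$ The probability is with respect to $X_1,\dots,X_n$; $\|\cdot\|_\infty$ is the supremum over $\mathbb{Z}$. *)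

(* Defs.v *)
From HB Require Import structures.
From mathcomp Require Import all_boot all_order all_algebra.
From mathcomp Require Import finmap.
From mathcomp Require Import all_classical all_reals all_analysis.
Set Implicit Arguments. Unset Strict Implicit. Unset Printing Implicit Defensive.
Import Order.TTheory GRing.Theory Num.Theory.
Local Open Scope ring_scope.


Definition int_interval (S : {fset int}) : Prop :=
  exists a b : int, forall x : int, (x \in S) = (a <= x <= b).

Definition origin_symmetric (S : {fset int}) : Prop :=
  forall x : int, x \in S -> - x \in S.

(* (N,n,K,delta)-admissible family A_1 x ... x A_n; coordinate i : 'I_n
   stands for the paper's index i+1. *)
Definition admissible {R : realType} (N n : nat) (K delta : R)
    (A : 'I_n -> {fset int}) : Prop :=
  [/\ forall i, origin_symmetric (A i),
      forall i : 'I_n, delta * n%:R < (i.+1)%:R ->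
        int_interval (A i) /\ (2 * N + 1 <= #|` A i|)%N,
      forall i : 'I_n, (i.+1)%:R <= delta * n%:R ->
        [/\ exists S1 S2 : {fset int}, int_interval S1 /\ int_interval S2 /\
               A i = (S1 `|` S2)%fset,
            (2 * N <= #|` A i|)%N &
            forall x : int, x \in A i -> ~ (- (N%:Z) <= x <= N%:Z)],
      (\prod_(i < n) (#|` A i|)%:R <= (K * N%:R) ^+ n :> R) &
      forall (i : 'I_n) (x : int), x \in A i -> x < (n * N)%:Z ].

(* The random function f_{A,p,l}, evaluated at a realisation x of
   (X_1, X_2, ...) (x j = X_{j+1}). *)
Definition frand {R : realType} (f : int -> R) (p : R) (l : nat)
    (x : nat -> int) (t : int) : R :=
  \sum_(v : {ffun 'I_l -> bool})
     p ^+ (\sum_(j < l) (v j : nat))%N * (1 - p) ^+ (l - \sum_(j < l) (v j : nat))%N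
     * f (t + \sum_(j < l) (v j : nat)%:Z * x j).

Definition sample (n : nat) (A : 'I_n -> {fset int}) : finType :=
  {dffun forall i : 'I_n, A i}.

Definition realise (n : nat) (A : 'I_n -> {fset int}) (w : sample A) : nat -> int :=
  fun j => match insub j with Some i => val (w i) | None => 0 end.

(* Probability of an event for X_1..X_n independent, X_i uniform on A_i:
   the uniform (counting) probability on the product space. *)
Definition prob {R : realType} (n : nat) (A : 'I_n -> {fset int})
    (E : (nat -> int) -> Prop) : R :=
  (#|[pred w : sample A | `[< E (realise w) >] ]|)%:R / (#|{: sample A}|)%:R.

Definition log2 {R : realType} (x : R) : R := ln x / ln 2.

(* log2 f is eta-Lipschitz (this presupposes f > 0 everywhere). *)
Definition log2_lipschitz {R : realType} (f : int -> R) (eta : R) : Prop :=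
  (forall t, 0 < f t) /\
  forall t : int, `|log2 (f t) - log2 (f (t + 1))| <= eta.

Definition l1_norm_one {R : realType} (f : int -> R) : Prop :=
  (\esum_(t in [set: int]) (f t)%:E = 1%E)%E.

(* Main.v *)
(* Write f_l for f averaged over the first l variables, so that f_(l+1) is
   (1 - p) f_l + p f_l(. + X_(l+1)).

   1. Energy: averaging with a step x lowers the sum of f^2 by p (1 - p) times the
   sum of (f - f(. + x))^2. Averaging over a few indices i <= delta n, where
   |X_i| > N, therefore brings the mass of every interval of length N down to
   O(1 / sqrt n), deterministically.

   2. Moments: the k-th moment of f_l(t) is an average over 0-1 matrices with k
   rows. Independent rows each contribute |f|_1 / (2 N), and by Odlyzko's bound a
   row depends on the previous ones with probability (1 - p)^(l - k), which is at
   most 1 / N when k is a small multiple of n. With Markov's inequality,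
   |f_l|_oo <= R / N outside an event of probability exp(- M n), for some R
   depending on M.

   3. Along a further block of indices the energy cannot decrease much at many
   steps, so, outside an event of small probability, some intermediate function g
   is almost invariant in l2 under a positive proportion rho of the shifts in some
   A_i. By pigeonhole g is then almost invariant under all multiples up to N of
   some q = q(rho). As log2 f is eta-Lipschitz with eta <= 1 / q, averaging g along
   such multiples amounts to averaging it over an interval of length N. Hence
   g <= O(1 / (N sqrt n)) + e with a constant independent of M and e small in l2,
   and the moment bound for e^2 over the next block makes e small in l_oo.

   Step 3 improves R / N to R' / (N sqrt n); applied once more it removes the
   dependence on M. *)
Require Import Defs.
From HB Require Import structures.
From mathcomp Require Import all_boot all_order all_algebra.
From mathcomp Require Import finmap.
From mathcomp Require Import all_classical all_reals all_analysis.
From mathcomp Require Import ring lra zify.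
Set Implicit Arguments. Unset Strict Implicit. Unset Printing Implicit Defensive.
Import Order.TTheory GRing.Theory Num.Theory.
Local Open Scope ring_scope.

(** * Words and finite sums *)

Section Words.
Variable T : eqType.
Implicit Types (As Bs : seq (seq T)) (w : seq T).

(** The product sample space as a list: concatenating supports concatenates words, so blocks of
    variables can be treated one after the other. *)
Fixpoint words As : seq (seq T) :=
  if As is A :: As' then [seq x :: w | x <- A, w <- words As'] else [:: [::]].

Lemma mem_words As w :
  (w \in words As) = (size w == size As) && all2 (fun x A => x \in A) w As.
Proof.
elim: As w => [|A As IH] [|x w] //=.
  by apply/negbTE/allpairsP => -[[y u]] /= [_ _].
rewrite eqSS; apply/allpairsP/idP => [[[y u]] /= [yA uA [-> ->]]|].
  by rewrite yA; move: uA; rewrite IH.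
by case/and3P => sz xA wA; exists (x, w); split => //=; rewrite IH sz.
Qed.

Lemma size_word As w : w \in words As -> size w = size As.
Proof. by rewrite mem_words => /andP[/eqP]. Qed.

Lemma nth_word x0 As w i : w \in words As -> (i < size As)%N ->
  nth x0 w i \in nth [::] As i.
Proof.
rewrite mem_words => /andP[/eqP + +].
elim: As w i => [|A As IH] [|x w] [|i] //= [sz] /andP[xA wA] lti //.
exact: IH.
Qed.

Lemma mem_wordsP x0 As w : size w = size As ->
  (forall i, (i < size As)%N -> nth x0 w i \in nth [::] As i) -> w \in words As.
Proof.
elim: As w => [|A As IH] [|x w] //= [sz] H.
apply/allpairsP; exists (x, w); split => //=; first exact: (H 0%N).
by apply: IH => // i lti; apply: (H i.+1).
Qed.

Lemma uniq_words As : all uniq As -> uniq (words As).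
Proof.
elim: As => //= A As IH /andP[uA uAs].
by apply: allpairs_uniq => [//||[x w] [y u] _ _ [-> ->]//]; apply: IH.
Qed.

Lemma size_words As : size (words As) = (\prod_(A <- As) size A)%N.
Proof.
elim: As => [|A As IH] /=; first by rewrite big_nil.
by rewrite size_allpairs IH big_cons.
Qed.

Section Sums.
Variables (V : nmodType).

Lemma sum_words_nil (F : seq T -> V) : \sum_(w <- words [::]) F w = F [::].
Proof. by rewrite /= big_seq1. Qed.

Lemma sum_words_cons A As (F : seq T -> V) :
  \sum_(w <- words (A :: As)) F w =
  \sum_(x <- A) \sum_(w <- words As) F (x :: w).
Proof. by rewrite /= big_allpairs_dep. Qed.

Lemma sum_words_cat As Bs (F : seq T -> V) :
  \sum_(w <- words (As ++ Bs)) F w =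
  \sum_(u <- words As) \sum_(w <- words Bs) F (u ++ w).
Proof.
elim: As F => [|A As IH] F; first by rewrite sum_words_nil.
rewrite cat_cons !sum_words_cons; apply: eq_bigr => x _.
by rewrite IH.
Qed.

End Sums.

Lemma prod_words (R : comPzSemiRingType) As (q : T -> R) :
  \sum_(w <- words As) \prod_(x <- w) q x = \prod_(A <- As) \sum_(x <- A) q x.
Proof.
elim: As => [|A As IH]; first by rewrite sum_words_nil !big_nil.
rewrite sum_words_cons big_cons -IH big_distrl /=; apply: eq_bigr => x _.
by rewrite big_distrr /=; apply: eq_bigr => w _; rewrite big_cons.
Qed.

End Words.

Section SumSeq.
Variables (R : numDomainType) (S : eqType).

Lemma ler_sum_in (s : seq S) (F G : S -> R) :
  {in s, forall x, F x <= G x} -> \sum_(x <- s) F x <= \sum_(x <- s) G x.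
Proof. by move=> FG; rewrite big_seq [leRHS]big_seq; apply: ler_sum. Qed.

Lemma sum_const_seq (s : seq S) (c : R) : \sum_(x <- s) c = (size s)%:R * c.
Proof.
elim: s => [|x s IH] /=; first by rewrite big_nil mul0r.
by rewrite big_cons IH -natr1 mulrDl mul1r addrC.
Qed.

Lemma sum_le_const (s : seq S) (F : S -> R) c :
  {in s, forall x, F x <= c} -> \sum_(x <- s) F x <= (size s)%:R * c.
Proof. by move=> le_c; rewrite -sum_const_seq; apply: ler_sum_in. Qed.

End SumSeq.

Section SumInj.
Variables (R : numDomainType) (S : eqType).

Lemma sum_le_subseq (s s' : seq S) (G : S -> R) :
  uniq s -> uniq s' -> {subset s <= s'} -> {in s', forall y, 0 <= G y} ->
  \sum_(x <- s) G x <= \sum_(y <- s') G y.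
Proof.
move=> us us' sub G0.
have pq : perm_eq s [seq y <- s' | y \in s].
  apply: uniq_perm; rewrite ?filter_uniq // => x.
  by rewrite mem_filter; case xs: (x \in s) => //=; rewrite sub.
rewrite (perm_big _ pq) big_filter [leRHS](bigID (mem s)) /= lerDl.
by rewrite big_seq_cond; apply: sumr_ge0 => y /andP[/G0].
Qed.

(** Serves the changes of variables below: an injection suffices, since the terms missed are
    nonnegative. *)
Lemma sum_le_inj (S' : eqType) (s' : seq S') (s : seq S) (phi : S' -> S)
    (F : S' -> R) (G : S -> R) :
  uniq s' -> uniq s -> {in s' &, injective phi} ->
  {in s', forall x, phi x \in s} ->
  {in s', forall x, F x <= G (phi x)} -> {in s, forall y, 0 <= G y} ->
  \sum_(x <- s') F x <= \sum_(y <- s) G y.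
Proof.
move=> us' us inj_phi sub leFG G0.
apply: (@le_trans _ _ (\sum_(y <- map phi s') G y)).
  by rewrite big_map; apply: ler_sum_in.
apply: sum_le_subseq => //; first by rewrite map_inj_in_uniq.
by move=> _ /mapP[x xs ->]; apply: sub.
Qed.

End SumInj.

(** * Bounds for sums over the integers *)

Section Summable.
Variable R : realFieldType.
Implicit Types (g h : int -> R) (s : seq int).

(** For nonnegative [g] this bounds the sum over all integers, with no discussion of convergence. *)
Definition mass_le g v := forall s, uniq s -> \sum_(t <- s) g t <= v.

Lemma mass_le_mono g h v :
  (forall t, g t <= h t) -> mass_le h v -> mass_le g v.
Proof. by move=> gh hv s us; apply: le_trans (hv s us); apply: ler_sum. Qed.

Lemma mass_leW g v w : v <= w -> mass_le g v -> mass_le g w.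
Proof. by move=> vw gv s us; apply: le_trans (gv s us) vw. Qed.

Lemma mass_le_shift x g v : mass_le g v -> mass_le (fun t => g (t + x)) v.
Proof.
move=> gv s us; rewrite -(big_map (fun t => t + x) xpredT g).
by apply: gv; rewrite map_inj_uniq //; apply: addIr.
Qed.

Lemma mass_leD g h v w :
  mass_le g v -> mass_le h w -> mass_le (fun t => g t + h t) (v + w).
Proof. by move=> gv hw s us; rewrite big_split lerD ?gv ?hw. Qed.

Lemma mass_leZ c g v : 0 <= c -> mass_le g v -> mass_le (fun t => c * g t) (c * v).
Proof. by move=> c0 gv s us; rewrite -big_distrr ler_wpM2l ?gv. Qed.

Lemma mass_le_sum (I : Type) (r : seq I) (G : I -> int -> R) (v : I -> R) :
  (forall i, mass_le (G i) (v i)) ->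
  mass_le (fun t => \sum_(i <- r) G i t) (\sum_(i <- r) v i).
Proof.
by move=> Gv s us; rewrite exchange_big /=; apply: ler_sum => i _; apply: Gv.
Qed.

Lemma mass_le_ge0 g v : mass_le g v -> 0 <= v.
Proof. by move=> /(_ [::] isT); rewrite big_nil. Qed.

Lemma mass_le_pt g v t : mass_le g v -> g t <= v.
Proof. by move=> /(_ [:: t] isT); rewrite big_seq1. Qed.

Lemma mass_le_sqr g B v : (forall t, 0 <= g t <= B) -> mass_le g v ->
  mass_le (fun t => g t ^+ 2) (B * v).
Proof.
move=> gB gv; have B0 : 0 <= B by have /andP[] := gB 0; apply: le_trans.
apply: (mass_le_mono _ (mass_leZ B0 gv)) => t.
by have /andP[g0 gl] := gB t; rewrite expr2 ler_wpM2r.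
Qed.

End Summable.

(** * Averaging along a word *)

Section Averaging.
Variables (R : realFieldType) (p : R).
Hypotheses (p_ge0 : 0 <= p) (p_le1 : p <= 1).
Implicit Types (f g : int -> R) (xs ys : seq int) (v : seq bool).

Definition step (x : int) f : int -> R := fun t => (1 - p) * f t + p * f (t + x).

(** Recursive form of the random function, suited to invariants along the word; [avg_bern] expands
    it over bit vectors. *)
Fixpoint avg f xs : int -> R :=
  if xs is x :: xs' then avg (step x f) xs' else f.

Lemma avg_cat f xs ys : avg f (xs ++ ys) = avg (avg f xs) ys.
Proof. by elim: xs f => //= x xs IH f. Qed.

Lemma avg_ind (Q : (int -> R) -> Prop) f xs :
  {in xs, forall x g, Q g -> Q (step x g)} -> Q f -> Q (avg f xs).
Proof.
elim: xs f => //= x xs IH f Qs Qf; apply: IH => [y yxs g|].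
  by apply: Qs; rewrite inE yxs orbT.
by apply: Qs => //; rewrite mem_head.
Qed.

Let q_ge0 : 0 <= 1 - p. Proof. by rewrite subr_ge0. Qed.

Lemma step_mono x f g : (forall t, f t <= g t) -> forall t, step x f t <= step x g t.
Proof. by move=> fg t; rewrite lerD // ler_wpM2l. Qed.

Lemma avg_mono f g xs : (forall t, f t <= g t) -> forall t, avg f xs t <= avg g xs t.
Proof.
by elim: xs f g => //= x xs IH f g fg; apply: IH => t; apply: step_mono.
Qed.

Lemma avg_cst c xs t : avg (fun=> c) xs t = c.
Proof.
elim: xs => //= x xs {2}<-; congr (avg _ _ _).
by apply/funext => u; rewrite /step; ring.
Qed.

Lemma avg_le f c xs : (forall t, f t <= c) -> forall t, avg f xs t <= c.
Proof. by move=> fc t; rewrite -(avg_cst c xs t); apply: avg_mono. Qed.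

Lemma avg_ge0 f xs : (forall t, 0 <= f t) -> forall t, 0 <= avg f xs t.
Proof. by move=> f0 t; rewrite -(avg_cst 0 xs t); apply: avg_mono. Qed.

Lemma avgD f g xs t : avg (fun u => f u + g u) xs t = avg f xs t + avg g xs t.
Proof.
elim: xs f g => //= x xs IH f g; rewrite -IH; congr (avg _ _ _).
by apply/funext => u; rewrite /step; ring.
Qed.

Lemma avgZ c f xs t : avg (fun u => c * f u) xs t = c * avg f xs t.
Proof.
elim: xs f => //= x xs IH f; rewrite -IH; congr (avg _ _ _).
by apply/funext => u; rewrite /step; ring.
Qed.

Lemma avg_shift f s xs t : avg (fun u => f (u + s)) xs t = avg f xs (t + s).
Proof.
elim: xs f => //= x xs IH f; rewrite -IH; congr (avg _ _ _).
by apply/funext => u; rewrite /step addrAC.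
Qed.

Lemma avg_sum (I : Type) (r : seq I) (F : I -> int -> R) xs t :
  avg (fun u => \sum_(i <- r) F i u) xs t = \sum_(i <- r) avg (F i) xs t.
Proof.
elim: r => [|i r IH].
  rewrite big_nil -[RHS](avg_cst 0 xs t); congr (avg _ _ _).
  by apply/funext => u; rewrite big_nil.
rewrite big_cons -IH -avgD; congr (avg _ _ _).
by apply/funext => u; rewrite big_cons.
Qed.

Lemma mass_le_avg f (v : R) xs : mass_le f v -> mass_le (avg f xs) v.
Proof.
apply: (avg_ind (Q := fun g => mass_le g v)) => x _ g gv.
have -> : v = (1 - p) * v + p * v by ring.
by apply: mass_leD; apply: mass_leZ => //; apply: mass_le_shift.
Qed.

(** The variance identity for a two-point law; the second term is the energy lost in one step. *)
Lemma step_sqrE x f t : (step x f t) ^+ 2 + p * (1 - p) * (f t - f (t + x)) ^+ 2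
  = (1 - p) * f t ^+ 2 + p * f (t + x) ^+ 2.
Proof. by rewrite /step; ring. Qed.

Let pq_ge0 : 0 <= p * (1 - p). Proof. exact: mulr_ge0. Qed.

Lemma avg_sqr_le f xs t : (avg f xs t) ^+ 2 <= avg (fun u => f u ^+ 2) xs t.
Proof.
elim: xs f => //= x xs IH f; apply: le_trans (IH _) _; apply: avg_mono => u.
rewrite [leRHS]/step -step_sqrE lerDl; apply: mulr_ge0 => //; exact: sqr_ge0.
Qed.

Lemma mass_le_avg_sqr f (v : R) xs : mass_le (fun t => f t ^+ 2) v ->
  mass_le (fun t => (avg f xs t) ^+ 2) v.
Proof. by move/(mass_le_avg xs); apply: mass_le_mono => t; apply: avg_sqr_le. Qed.

Lemma energy_decrement x f (v c : R) :
  mass_le (fun t => f t ^+ 2) v ->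
  ~ mass_le (fun t => (f t - f (t + x)) ^+ 2) c ->
  mass_le (fun t => (step x f t) ^+ 2) (v - p * (1 - p) * c).
Proof.
move=> fv nc s us.
have [s0 us0 sc] : exists2 s0, uniq s0 & c < \sum_(t <- s0) (f t - f (t + x)) ^+ 2.
  apply: contrapT => nex; apply: nc => s0 us0; rewrite leNgt; apply/negP => lt.
  by apply: nex; exists s0.
(* Both finite lists are enlarged to a common one, on which [step_sqrE] is summed. *)
set s1 := undup (s ++ s0).
have us1 : uniq s1 by apply: undup_uniq.
have sub (s' : seq int) (G : int -> R) : uniq s' -> {subset s' <= s ++ s0} ->
    (forall t, 0 <= G t) -> \sum_(t <- s') G t <= \sum_(t <- s1) G t.
  move=> us' ss' G0; apply: sum_le_subseq => // t.
  by rewrite mem_undup => /ss'.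
have h1 : \sum_(t <- s) step x f t ^+ 2 <= \sum_(t <- s1) step x f t ^+ 2.
  apply: sub => // [t ts|t]; [by rewrite mem_cat ts | exact: sqr_ge0].
have h0 : \sum_(t <- s0) (f t - f (t + x)) ^+ 2 <= \sum_(t <- s1) (f t - f (t + x)) ^+ 2.
  apply: sub => // [t ts|t]; [by rewrite mem_cat ts orbT | exact: sqr_ge0].
have : \sum_(t <- s1) step x f t ^+ 2
    + p * (1 - p) * \sum_(t <- s1) (f t - f (t + x)) ^+ 2 <= v.
  rewrite big_distrr -big_split /=.
  under eq_bigr do rewrite step_sqrE.
  have -> : v = (1 - p) * v + p * v by ring.
  have : mass_le (fun t => (1 - p) * f t ^+ 2 + p * f (t + x) ^+ 2) ((1 - p) * v + p * v).
    by apply: mass_leD; apply: mass_leZ => //; apply: (mass_le_shift x fv).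
  exact.
have : p * (1 - p) * c <= p * (1 - p) * \sum_(t <- s1) (f t - f (t + x)) ^+ 2.
  by apply: ler_wpM2l => //; apply: le_trans (ltW sc) h0.
lra.
Qed.

Definition bits n : seq (seq bool) := words (nseq n [:: true; false]).

Definition bern v : R := \prod_(b <- v) (if b then p else 1 - p).

Fixpoint dot v xs : int :=
  match v, xs with
  | b :: v', x :: xs' => (b : nat)%:Z * x + dot v' xs'
  | _, _ => 0
  end.

Lemma bern_ge0 v : 0 <= bern v.
Proof. by apply: prodr_ge0 => -[]. Qed.

Lemma sum_bern n : \sum_(v <- bits n) bern v = 1.
Proof.
rewrite prod_words big_nseq; elim: n => //= n ->.
by rewrite !big_cons big_nil /=; ring.
Qed.

Lemma uniq_bits n : uniq (bits n).
Proof. by apply: uniq_words; apply/allP => A /nseqP[-> _]. Qed.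

Lemma size_bits n v : v \in bits n -> size v = n.
Proof. by move/size_word; rewrite size_nseq. Qed.

Lemma mem_bits v : v \in bits (size v).
Proof.
apply: (mem_wordsP (x0 := false)) => [|i]; rewrite size_nseq // => lti.
by rewrite nth_nseq lti; case: nth.
Qed.

Lemma avg_bern f xs t :
  avg f xs t = \sum_(v <- bits (size xs)) bern v * f (t + dot v xs).
Proof.
elim: xs f t => [|x xs IH] f t.
  by rewrite /bits sum_words_nil /= /bern big_nil addr0 mul1r.
rewrite [avg _ _ _]/= IH /bits [nseq _ _]/= sum_words_cons !big_cons big_nil addr0.
rewrite -big_split /=; apply: eq_bigr => v _.
rewrite /bern !big_cons /step mul1r mul0r add0r [x + _]addrC addrA; ring.
Qed.

Lemma dotE n v xs : size v = n -> size xs = n ->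
  dot v xs = \sum_(j < n) (nth false v j : nat)%:Z * nth 0 xs j.
Proof.
elim: n v xs => [|n IH] [|b v] [|x xs] //= => [_ _|[sv] [sx]].
  by rewrite big_ord0.
by rewrite big_ord_recl (IH v xs).
Qed.

Lemma dotN v xs : dot v (map -%R xs) = - dot v xs.
Proof.
elim: v xs => [|b v IH] [|x xs] //=; rewrite ?oppr0 //.
by rewrite IH opprD mulrN.
Qed.

End Averaging.

(** * Linear forms with integer coefficients *)

Section Pivots.
Variables (r n : nat).
Implicit Types (U : 'M[int]_(r, n)) (x : seq int).

Definition ratm m k (U : 'M[int]_(m, k)) : 'M[rat]_(m, k) := map_mx intr U.

Lemma pivots U : row_free (ratm U) ->
  exists2 J : 'I_r -> 'I_n, injective J & colsub J (ratm U) \in unitmx.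
Proof.
move=> fU; have fUT : row_full (ratm U)^T by rewrite /row_full mxrank_tr.
exists (fullrankfun fUT); first exact: fullrankfun_inj.
by rewrite -unitmx_tr trmx_mxsub fullrowsub_unit.
Qed.

Lemma big_pivots (V : Type) (idx : V) (op : Monoid.com_law idx)
    (J : 'I_r -> 'I_n) (F : 'I_n -> V) : injective J ->
  \big[op/idx]_j F j =
  op (\big[op/idx]_a F (J a)) (\big[op/idx]_(j | j \notin codom J) F j).
Proof.
move=> injJ; rewrite (bigID (mem (codom J))) /=; congr (op _ _).
rewrite -big_uniq; last by rewrite map_inj_uniq ?enum_uniq.
by rewrite big_image.
Qed.

Lemma card_nonpivots (J : 'I_r -> 'I_n) : injective J ->
  #|[pred j | j \notin codom J]| = (n - r)%N.
Proof.
move=> injJ; have := cardC (mem (codom J)).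
rewrite card_codom // !card_ord => /(congr1 (subn^~ r)); rewrite addKn => <-.
exact: eq_card.
Qed.

Definition linform U x (a : 'I_r) : int := \sum_(j < n) U a j * x`_j.

(** The difference of the two vectors lives on the pivot columns, where the matrix is invertible, so
    equal values of the forms force it to vanish. *)
Lemma linform_inj U (J : 'I_r -> 'I_n) x y :
  injective J -> colsub J (ratm U) \in unitmx ->
  size x = n -> size y = n ->
  (forall j, j \notin codom J -> x`_j = y`_j) ->
  (forall a, linform U x a = linform U y a) -> x = y.
Proof.
move=> injJ uJ sx sy offJ eqf.
pose d : 'cV[rat]_r := \col_a (x`_(J a) - y`_(J a))%:~R.
have d0 : d = 0.
  rewrite -[d](mulKmx uJ); suff -> : colsub J (ratm U) *m d = 0 by rewrite mulmx0.
  apply/colP => a; rewrite !mxE.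
  have : (linform U x a - linform U y a)%:~R = 0 :> rat by rewrite eqf subrr.
  rewrite /linform -sumrB (big_pivots _ _ injJ) /= addrC big1 => [|j jJ]; last first.
    by rewrite offJ // subrr.
  rewrite add0r rmorph_sum /= => e0; apply: etrans e0.
  by apply: eq_bigr => b _; rewrite !mxE -mulrBr rmorphM.
apply: (@eq_from_nth _ 0) => [|i]; rewrite sx ?sy // => lti.
have [/codomP[a ja]|] := boolP (Ordinal lti \in codom J); last exact: offJ.
have /colP/(_ a) := d0; rewrite !mxE -ja /= => /eqP.
by rewrite intr_eq0 subr_eq0 => /eqP.
Qed.

End Pivots.

Section Counting.
Variables (R : realFieldType) (r n : nat).
Variable U : 'M[int]_(r, n).
Hypothesis freeU : row_free (ratm U).

(** The non-pivot coordinates and the values of the [r] forms determine the word. Summing [psi] over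
    the values gives at most [v ^+ r], and dropping the [r] pivot coordinates removes a factor of at
    least [a ^+ r] from the number of words. *)
Lemma sum_linform_le (Bs : seq (seq int)) (a : nat) (psi : int -> R) (v : R) (t : int) :
  size Bs = n -> all uniq Bs -> {in Bs, forall B, (a <= size B)%N} ->
  (forall u, 0 <= psi u) -> mass_le psi v ->
  a%:R ^+ r * \sum_(x <- words Bs) \prod_(b < r) psi (t + linform U x b)
    <= v ^+ r * (size (words Bs))%:R.
Proof.
move=> sB uB aB psi0 psiv.
have [J injJ uJ] := pivots freeU.
pose Bs' := mkseq (fun j => if j \in map val (codom J) then [:: 0]
                            else nth [::] Bs j) n.
(* A finite list of all values taken by the forms; [phi] encodes a word by these values and its
   non-pivot coordinates, with 0 put at the pivots. *)
pose Z := undup [seq t + linform U x b | x <- words Bs, b <- enum 'I_r].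
pose phi x := (mkseq (fun j => if j \in map val (codom J) then 0 else x`_j) n,
               [seq t + linform U x b | b <- enum 'I_r]).
have inJ (j : 'I_n) : (val j \in map val (codom J)) = (j \in codom J).
  by rewrite mem_map //; apply: val_inj.
have sBs' : size Bs' = n by rewrite size_mkseq.
have uBs' : all uniq Bs'.
  apply/allP => A /mapP[j]; rewrite mem_iota => /= ltj ->; case: ifP => // _.
  by apply: (allP uB); rewrite mem_nth // sB.
have step1 : \sum_(x <- words Bs) \prod_(b < r) psi (t + linform U x b) <=
    \sum_(yz <- [seq (y, z) | y <- words Bs', z <- words (nseq r Z)])
      \prod_(c <- yz.2) psi c.
  apply: (sum_le_inj (phi := phi)).
  - exact: uniq_words.
  - apply: allpairs_uniq; [exact: uniq_words | | by move=> [? ?] [? ?] /=].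
    by apply: uniq_words; apply/allP => A /nseqP[-> _]; apply: undup_uniq.
  - move=> x y xB yB [e1 e2].
    apply: (linform_inj injJ uJ); rewrite ?(size_word xB) ?(size_word yB) //.
      move=> j jJ; have := congr1 (nth 0 ^~ j) e1.
      by rewrite !nth_mkseq // inJ (negPf jJ).
    move=> b; have /eq_in_map/(_ b) := e2.
    by rewrite mem_enum => /(_ isT) /addrI.
  - move=> x xB; apply/allpairsP; exists (phi x); split; rewrite -?surjective_pairing //.
      apply: (mem_wordsP (x0 := 0)) => [|j]; rewrite ?size_mkseq // => ltj.
      rewrite !nth_mkseq //; case: ifP => _; first by rewrite mem_seq1.
      by apply: nth_word; rewrite // sB.
    apply: (mem_wordsP (x0 := 0)) => [|j]; rewrite size_nseq.
      by rewrite /phi size_map size_enum_ord.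
    move=> ltj; rewrite nth_nseq ltj mem_undup (nth_map (Ordinal ltj)) ?size_enum_ord //.
    by apply/allpairsP; eexists (x, _); split; rewrite //= mem_enum.
  - by move=> x xB; rewrite /= big_map big_enum.
  - by move=> [y z] _; apply: prodr_ge0.
have step2 : \sum_(yz <- [seq (y, z) | y <- words Bs', z <- words (nseq r Z)])
    \prod_(c <- yz.2) psi c <= (size (words Bs'))%:R * v ^+ r.
  rewrite big_allpairs /= -sum_const_seq; apply: ler_sum => y _.
  rewrite prod_words big_nseq iter_mulr_1.
  have Z0 : 0 <= \sum_(x <- Z) psi x by apply: sumr_ge0.
  have Zv : \sum_(x <- Z) psi x <= v by apply: psiv; apply: undup_uniq.
  by rewrite lerXn2r ?nnegrE // (le_trans Z0).
have step3 : (a ^ r * size (words Bs') <= size (words Bs))%N.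
  rewrite !size_words.
  have -> : (\prod_(A <- Bs) size A = \prod_(j < n) size (nth [::] Bs j))%N.
    by rewrite (big_nth [::]) sB big_mkord.
  have -> : (\prod_(A <- Bs') size A = \prod_(j < n)
      (if val j \in map val (codom J) then 1 else size (nth [::] Bs j)))%N.
    rewrite big_map -{1}[n]subn0 -/(index_iota 0 n) big_mkord.
    by apply: eq_bigr => j _; case: ifP.
  rewrite !(big_pivots _ _ injJ) /=.
  rewrite [X in (_ * (X * _) <= _)%N]big1 => [|b _]; last by rewrite inJ codom_f.
  rewrite mul1n leq_mul //.
    rewrite -{1}[r]card_ord -prod_nat_const; apply: leq_prod => b _.
    by apply: aB; rewrite mem_nth // sB.
  by apply: leq_prod => j jJ; rewrite inJ (negPf jJ).
apply: (@le_trans _ _ (a%:R ^+ r * ((size (words Bs'))%:R * v ^+ r))).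
  by rewrite ler_wpM2l ?exprn_ge0 //; apply: le_trans step1 step2.
rewrite mulrA [leRHS]mulrC ler_wpM2r ?exprn_ge0 ?(mass_le_ge0 psiv) //.
by rewrite -natrX -natrM ler_nat.
Qed.

Variable p : R.
Hypotheses (p_ge0 : 0 <= p) (p_le12 : p <= 1 / 2).

Definition dep (c : 'I_n -> int) (v : seq bool) : bool :=
  (ratm (\row_j ((nth false v j : nat)%:Z - c j)) <= ratm U)%MS.

(* Odlyzko's bound: the pivot coordinates of a bit vector lying in a given
   affine translate of the row space determine the other ones. *)
Lemma sum_dep_le (c : 'I_n -> int) :
  \sum_(v <- bits n | dep c v) bern p v <= (1 - p) ^+ (n - r).
Proof.
have [J injJ uJ] := pivots freeU.
pose phi (v : seq bool) := [seq nth false v (J a) | a <- enum 'I_r].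
have [hp0 hp] := (p_ge0, p_le12).
have q0 : 0 <= 1 - p by lra.
have sphi v : size (phi v) = r by rewrite size_map size_enum_ord.
apply: (@le_trans _ _ (\sum_(u <- bits r) (1 - p) ^+ (n - r) * bern p u)); last first.
  by rewrite -big_distrr /= sum_bern mulr1.
rewrite -big_filter; apply: (sum_le_inj (phi := phi)).
- by rewrite filter_uniq // uniq_bits.
- exact: uniq_bits.
- move=> v w; rewrite !mem_filter => /andP[/submxP[D vD] vb] /andP[/submxP[D' wD'] wb] evw.
  have eJ a : nth false v (J a) = nth false w (J a).
    have /eq_in_map/(_ a) := evw.
    by rewrite mem_enum => /(_ isT).
  (* The pivot columns are invertible, so agreement there forces equal coefficients in the row
     space, hence equal vectors. *)
  have DD' : D = D'.
    apply/eqP; rewrite -subr_eq0; apply/eqP.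
    rewrite -[D - D'](mulmxK uJ).
    suff -> : (D - D') *m colsub J (ratm U) = 0 by rewrite mul0mx.
    rewrite mulmx_colsub mulmxBl -vD -wD'.
    by apply/matrixP => i a; rewrite !mxE eJ subrr.
  apply: (@eq_from_nth _ false) => [|i]; rewrite (size_bits vb) ?(size_bits wb) // => lti.
  have : ratm (\row_j ((nth false v j : nat)%:Z - c j))
       = ratm (\row_j ((nth false w j : nat)%:Z - c j)) by rewrite vD wD' DD'.
  move=> /matrixP/(_ 0 (Ordinal lti)); rewrite !mxE /= => /eqP.
  by rewrite eqr_int => /eqP/addIr; case: nth; case: nth.
- by move=> v _; rewrite -(sphi v) mem_bits.
- move=> v; rewrite mem_filter => /andP[_ vb].
  have bE : bern p v = \prod_(j < n) (if nth false v j then p else 1 - p).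
    by rewrite /bern (big_nth false) (size_bits vb) big_mkord.
  rewrite bE (big_pivots _ _ injJ) /= mulrC /bern big_map big_enum /=.
  rewrite ler_wpM2r //; first by apply: prodr_ge0 => a _; case: ifP.
  (* Each non-pivot bit contributes [p] or [1 - p], both at most [1 - p] as [p <= 1 / 2]. *)
  rewrite -(card_nonpivots injJ) -prodr_const; apply: ler_prod => j _.
  by case: ifP => _; lra.
- by move=> u _; apply: mulr_ge0; [apply: exprn_ge0|apply: bern_ge0; lra].
Qed.

End Counting.

(** * Moments *)

Lemma linform_col_mxu r n (w : 'M[int]_(1, n)) (U : 'M[int]_(r, n)) x :
  linform (col_mx w U) x (lshift r 0) = \sum_(j < n) w 0 j * x`_j.
Proof. by apply: eq_bigr => j _; rewrite col_mxEu. Qed.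

Lemma linform_col_mxd r n (w : 'M[int]_(1, n)) (U : 'M[int]_(r, n)) x b :
  linform (col_mx w U) x (rshift 1 b) = linform U x b.
Proof. by apply: eq_bigr => j _; rewrite col_mxEd. Qed.

Lemma row_free_col_mx (F : fieldType) r n (w : 'rV[F]_n) (U : 'M[F]_(r, n)) :
  row_free U -> ~~ (w <= U)%MS -> row_free (col_mx w U).
Proof.
move=> /eqP rU nwU; rewrite /row_free eqn_leq rank_leq_row /=.
suff : (\rank U < \rank (col_mx w U))%N by rewrite rU.
apply: rank_ltmx; rewrite ltmxE col_mx_sub negb_and nwU andbT.
by have := submx_refl (col_mx w U); rewrite col_mx_sub => /andP[].
Qed.

Section Moments.
Variables (R : realFieldType) (p : R).
Hypotheses (p_ge0 : 0 <= p) (p_le12 : p <= 1 / 2).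
Variables (n : nat) (Bs : seq (seq int)) (a : nat) (psi : int -> R) (v b : R).
Hypotheses (sizeBs : size Bs = n) (uniqBs : all uniq Bs) (a_gt0 : (0 < a)%N).
Hypothesis aBs : {in Bs, forall B, (a <= size B)%N}.
Hypotheses (psi0 : forall u, 0 <= psi u) (psib : forall u, psi u <= b).
Hypothesis psiv : mass_le psi v.

Let shifted t (c : 'I_n -> int) (x : seq int) (u : seq bool) : R :=
  psi (t + \sum_(j < n) ((nth false u j : nat)%:Z - c j) * x`_j).

(* Induction on k: a new row of bits outside the row space of U gains a factor
   v / a, and by Odlyzko's bound it lies inside with exponentially small
   probability, in which case psi is bounded by b. *)
Lemma moment_free (m k r : nat) (U : 'M[int]_(r, n)) (t : int) (c : 'I_n -> int) :
  row_free (ratm U) -> (r + k <= m)%N ->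
  \sum_(x <- words Bs) (\prod_(i < r) psi (t + linform U x i)) *
      (\sum_(u <- bits n) bern p u * shifted t c x u) ^+ k
    <= (size (words Bs))%:R * (v / a%:R) ^+ r *
       (v / a%:R + b * (1 - p) ^+ (n - m)) ^+ k.
Proof.
have [hp0 hp] := (p_ge0, p_le12).
have v0 : 0 <= v := mass_le_ge0 psiv.
have bern0 u : 0 <= bern p u by apply: bern_ge0; lra.
have b0 : 0 <= b by apply: le_trans (psi0 0) (psib 0).
have q0 : 0 <= 1 - p by lra.
have q1 : 1 - p <= 1 by lra.
have a0 : 0 < a%:R :> R by rewrite ltr0n.
have th0 : 0 <= v / a%:R by rewrite divr_ge0 ?ler0n.
set th := v / a%:R in th0 *; set c0 := (1 - p) ^+ (n - m).
have c00 : 0 <= c0 by rewrite exprn_ge0.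
have Q0 k' r' : 0 <= (size (words Bs))%:R * th ^+ r' * (th + b * c0) ^+ k'.
  have w0 : 0 <= th + b * c0 by rewrite addr_ge0 // mulr_ge0.
  by apply: mulr_ge0; [apply: mulr_ge0|]; rewrite ?ler0n ?exprn_ge0.
elim: k r U => [|k IH] r U freeU rkm.
  rewrite mulr1; under eq_bigr do rewrite mulr1.
  rewrite expr_div_n mulrA ler_pdivlMr ?exprn_gt0 // mulrC [leRHS]mulrC.
  exact: sum_linform_le.
pose P x := \prod_(i < r) psi (t + linform U x i).
pose G x := \sum_(u <- bits n) bern p u * shifted t c x u.
have P0 x : 0 <= P x by apply: prodr_ge0.
have G0 x : 0 <= G x.
  by apply: sumr_ge0 => u _; apply: mulr_ge0 => //; apply: psi0.
have Bk u : \sum_(x <- words Bs) P x * shifted t c x u * G x ^+ k <=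
    (size (words Bs))%:R * th ^+ r * (th + b * c0) ^+ k *
    (th + b * (dep U c u)%:R).
  have [du|ndu] := boolP (dep U c u); last first.
    pose w : 'rV[int]_n := \row_j ((nth false u j : nat)%:Z - c j).
    have freeU' : row_free (ratm (col_mx w U)).
      by rewrite /ratm map_col_mx; apply: row_free_col_mx.
    have rkm' : (1 + r + k <= m)%N by rewrite -addnA add1n -addnS.
    apply: (@le_trans _ _ ((size (words Bs))%:R * th ^+ (1 + r) * (th + b * c0) ^+ k)); last first.
      by rewrite add1n exprSr mulr0 addr0 [leRHS]mulrAC mulrA.
    apply: le_trans (IH _ (col_mx w U) freeU' rkm').
    apply: ler_sum => x _; rewrite ler_wpM2r ?exprn_ge0 //.
    rewrite big_split_ord /= big_ord1 linform_col_mxu mulrC.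
    under [X in _ <= _ * X]eq_bigr do rewrite linform_col_mxd.
    rewrite /shifted /P le_eqVlt; apply/orP; left; apply/eqP.
    by congr (psi (t + _) * _); apply: eq_bigr => j _; rewrite mxE.
  apply: (@le_trans _ _ (b * \sum_(x <- words Bs) P x * G x ^+ k)).
    rewrite big_distrr; apply: ler_sum => x _ /=.
    rewrite mulrA ler_wpM2r ?exprn_ge0 // mulrC ler_wpM2r //.
    exact: psib.
  apply: (@le_trans _ _ (b * ((size (words Bs))%:R * th ^+ r * (th + b * c0) ^+ k))).
    rewrite ler_wpM2l //; apply: IH => //.
    by rewrite (leq_trans _ rkm) // leq_add2l.
  by rewrite mulrC ler_wpM2l ?Q0 // mulr1 lerDr.
have -> : \sum_(x <- words Bs) P x * G x ^+ k.+1 =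
   \sum_(u <- bits n) bern p u * \sum_(x <- words Bs) P x * shifted t c x u * G x ^+ k.
  under [RHS]eq_bigr do rewrite big_distrr /=.
  rewrite exchange_big /=; apply: eq_bigr => x _.
  rewrite exprS mulrCA {1}/G big_distrl /=; apply: eq_bigr => u _.
  by rewrite -!mulrA; congr (_ * _); rewrite mulrCA.
apply: (@le_trans _ _ (\sum_(u <- bits n) bern p u *
  ((size (words Bs))%:R * th ^+ r * (th + b * c0) ^+ k * (th + b * (dep U c u)%:R)))).
  by apply: ler_sum => u _; rewrite ler_wpM2l.
rewrite exprSr [leRHS]mulrA.
under eq_bigr do rewrite mulrCA.
rewrite -big_distrr /= ler_wpM2l ?Q0 //.
under eq_bigr do rewrite mulrDr.
rewrite big_split /= -big_distrl /= sum_bern mul1r lerD2l.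
have -> : \sum_(u <- bits n) bern p u * (b * (dep U c u)%:R) =
   b * \sum_(u <- bits n | dep U c u) bern p u.
  rewrite big_distrr [RHS]big_mkcond /=; apply: eq_bigr => u _.
  by case: (dep U c u); rewrite ?mulr1 ?mulr0 // mulrC.
rewrite ler_wpM2l //.
apply: le_trans (sum_dep_le freeU p_ge0 p_le12 c) _.
rewrite ler_wiXn2l // leq_sub2l //.
by rewrite (leq_trans _ rkm) // leq_addr.
Qed.

(* The first copy of avg is spent on the sum over t, by translating t; this turns
   the other rows of bits u into differences u - u0. *)
Lemma moment_bound (k : nat) (T : seq int) : uniq T -> (k <= n)%N ->
  \sum_(x <- words Bs) \sum_(t <- T) avg p psi x t ^+ k.+1
    <= (size (words Bs))%:R * v * (v / a%:R + b * (1 - p) ^+ (n - k)) ^+ k.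
Proof.
move=> uT kn.
have [hp0 hp] := (p_ge0, p_le12).
have bern0 u : 0 <= bern p u by apply: bern_ge0; lra.
pose off (u0 : seq bool) (j : 'I_n) := (nth false u0 j : nat)%:Z.
pose G u0 x t := (\sum_(u <- bits n) bern p u * shifted t (off u0) x u) ^+ k.
have G0 u0 x t : 0 <= G u0 x t.
  by apply/exprn_ge0/sumr_ge0 => u _; apply: mulr_ge0 => //; apply: psi0.
have GE u0 x t : u0 \in bits n -> x \in words Bs ->
    avg p psi x t ^+ k = G u0 x (t + dot u0 x).
  move=> u0n xB; congr (_ ^+ _); rewrite avg_bern (size_word xB) sizeBs.
  apply: eq_big_seq => u un; congr (_ * psi _).
  have sx : size x = n by rewrite (size_word xB).
  rewrite (dotE (size_bits un) sx) (dotE (size_bits u0n) sx) -addrA -big_split /=.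
  by congr (_ + _); apply: eq_bigr => j _; rewrite /off; ring.
(* A finite list containing every translate [t + dot u0 x], independent of the word [x]. *)
pose T' := undup [seq t + d | t <- T, d <- [seq dot u x | u <- bits n, x <- words Bs]].
have main u0 : u0 \in bits n ->
   \sum_(x <- words Bs) \sum_(t <- T) psi (t + dot u0 x) * avg p psi x t ^+ k
   <= (size (words Bs))%:R * v * (v / a%:R + b * (1 - p) ^+ (n - k)) ^+ k.
  move=> u0n.
  apply: (@le_trans _ _ (\sum_(x <- words Bs) \sum_(t <- T') psi t * G u0 x t)).
    apply: ler_sum_in => x xB.
    apply: (sum_le_inj (phi := fun t => t + dot u0 x)) => //.
    - exact: undup_uniq.
    - by move=> t t' _ _ /addIr.
    - move=> t tT; rewrite mem_undup; apply/allpairsP; exists (t, dot u0 x).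
      by split => //=; apply/allpairsP; exists (u0, x).
    - by move=> t tT; rewrite -GE.
    - by move=> t _; apply: mulr_ge0.
  rewrite exchange_big /=.
  apply: (@le_trans _ _ (\sum_(t <- T') psi t *
     ((size (words Bs))%:R * (v / a%:R + b * (1 - p) ^+ (n - k)) ^+ k))).
    apply: ler_sum => t _; rewrite -big_distrr ler_wpM2l //=.
    have free0 : row_free (ratm (0 : 'M[int]_(0, n))).
      by rewrite /row_free -leqn0 rank_leq_row.
    have := moment_free t (off u0) free0 (leqnn k).
    rewrite expr0 mulr1; apply: le_trans; rewrite le_eqVlt; apply/orP; left; apply/eqP.
    by apply: eq_bigr => x _; rewrite big_ord0 mul1r.
  rewrite -big_distrl /= [leRHS]mulrAC [leRHS]mulrC ler_wpM2r //; last first.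
    exact/psiv/undup_uniq.
  apply: mulr_ge0; rewrite ?ler0n ?exprn_ge0 // addr_ge0 ?divr_ge0 ?ler0n ?(mass_le_ge0 psiv) //.
  apply: mulr_ge0; last by rewrite exprn_ge0 //; lra.
  exact: le_trans (psi0 0) (psib 0).
set C := leRHS; have -> : C = \sum_(u <- bits n) bern p u * C.
  by rewrite -big_distrl /= sum_bern mul1r.
have -> : \sum_(x <- words Bs) \sum_(t <- T) avg p psi x t ^+ k.+1 =
  \sum_(u0 <- bits n) bern p u0 *
   \sum_(x <- words Bs) \sum_(t <- T) psi (t + dot u0 x) * avg p psi x t ^+ k.
  under [RHS]eq_bigr do rewrite big_distrr /=.
  rewrite [RHS]exchange_big; apply: eq_big_seq => x xB /=.
  under [RHS]eq_bigr do rewrite big_distrr /=.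
  rewrite [RHS]exchange_big; apply: eq_big_seq => t tT /=.
  rewrite exprS {1}avg_bern (size_word xB) sizeBs big_distrl /=.
  by apply: eq_bigr => u _; rewrite mulrA.
by apply: ler_sum_in => u un; rewrite ler_wpM2l ?main.
Qed.

End Moments.

(** * Tail probabilities *)

Section Probability.
Variable R : realFieldType.
Implicit Types (As Bs : seq (seq int)) (P Q : seq int -> Prop).

(** Denominator-free, hence meaningful also when some support is empty. *)
Definition prob_le As P (c : R) : Prop :=
  \sum_(w <- words As) (`[< P w >])%:R <= c * (size (words As))%:R.

Lemma prob_leW As P (c d : R) : c <= d -> prob_le As P c -> prob_le As P d.
Proof. by move=> cd /le_trans; apply; rewrite ler_wpM2r ?ler0n. Qed.

Lemma prob_le_mono As P Q c :
  {in words As, forall w, P w -> Q w} -> prob_le As Q c -> prob_le As P c.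
Proof.
move=> PQ; apply: le_trans; apply: ler_sum_in => w wA.
case: asboolP => Pw; last exact: ler0n.
by rewrite asboolT //; apply: PQ.
Qed.

Lemma prob_le_false As P c : 0 <= c ->
  {in words As, forall w, ~ P w} -> prob_le As P c.
Proof.
move=> c0 nP; rewrite /prob_le big1_seq => [|w /andP[_ wA]].
  by rewrite mulr_ge0 ?ler0n.
by rewrite asboolF //; apply: nP.
Qed.

Lemma prob_le1 As P : prob_le As P 1.
Proof.
rewrite /prob_le mulrC; apply: sum_le_const => w _.
by rewrite lern1; case: asbool.
Qed.

(** Union bound by conditioning on the first block: the words satisfying [Q] cost [c], and after any
    other word the second block fails with conditional probability at most [d]. *)
Lemma prob_le_cat As Bs P Q c d : 0 <= d -> prob_le As Q c ->
  {in words As, forall x, ~ Q x -> prob_le Bs (fun y => P (x ++ y)) d} ->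
  prob_le (As ++ Bs) P (c + d).
Proof.
move=> d0 Qc Pd.
have sz : (size (words (As ++ Bs)))%:R =
    (size (words As))%:R * (size (words Bs))%:R :> R.
  by rewrite !size_words big_cat natrM.
rewrite /prob_le sum_words_cat sz.
apply: (@le_trans _ _ (\sum_(x <- words As)
    ((`[< Q x >])%:R * (size (words Bs))%:R + d * (size (words Bs))%:R))).
  apply: ler_sum_in => x xA; case: asboolP => Qx.
    rewrite mul1r -[leLHS]addr0 lerD ?mulr_ge0 ?ler0n //.
    by have := prob_le1 Bs (fun y => P (x ++ y)); rewrite /prob_le mul1r.
  by rewrite mul0r add0r; apply: Pd.
rewrite big_split /= sum_const_seq -big_distrl /= mulrDl.
rewrite lerD //; last by rewrite mulrCA.
by rewrite mulrA ler_wpM2r ?ler0n.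
Qed.

(** Markov's inequality for the moment of order [k.+1]. *)
Lemma moment_tail (p : R) n Bs (a : nat) (psi : int -> R) (v b lam : R) (k : nat) :
  0 <= p -> p <= 1 / 2 -> size Bs = n -> all uniq Bs -> (0 < a)%N ->
  {in Bs, forall B, (a <= size B)%N} ->
  (forall u, 0 <= psi u) -> (forall u, psi u <= b) -> mass_le psi v ->
  0 < lam -> (k <= n)%N ->
  prob_le Bs (fun x => exists t, lam < avg p psi x t)
    (v / lam * ((v / a%:R + b * (1 - p) ^+ (n - k)) / lam) ^+ k).
Proof.
move=> p0 p12 sB uB a0 aB psi0 psib psiv lam0 kn.
(* One exceeding point is chosen for each word, with default 0. These points form a finite list, to
   which [moment_bound] applies. *)
pose tx x := match pselect (exists t, lam < avg p psi x t) with
  | left e => sval (cid e) | right _ => 0 end.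
have txP x : (exists t, lam < avg p psi x t) -> lam < avg p psi x (tx x).
  by rewrite /tx; case: pselect => // e _; case: (cid e).
pose T := undup (map tx (words Bs)).
have := moment_bound p0 p12 sB uB a0 aB psi0 psib psiv (undup_uniq (map tx (words Bs))) kn.
rewrite -/T => mb.
have l1 : 0 < lam ^+ k.+1 by rewrite exprn_gt0.
rewrite /prob_le expr_div_n.
have -> : v / lam * ((v / a%:R + b * (1 - p) ^+ (n - k)) ^+ k / lam ^+ k) *
    (size (words Bs))%:R = (size (words Bs))%:R * v *
   (v / a%:R + b * (1 - p) ^+ (n - k)) ^+ k / lam ^+ k.+1.
  by rewrite exprS invfM; ring.
rewrite ler_pdivlMr //; apply: le_trans mb; rewrite big_distrl /=.
apply: ler_sum_in => x xB.
have g0 t : 0 <= avg p psi x t ^+ k.+1.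
  by rewrite exprn_ge0 // avg_ge0 //; lra.
case: asboolP => [/txP lx|_]; last by rewrite mul0r sumr_ge0.
rewrite mul1r; apply: (@le_trans _ _ (\sum_(t <- [:: tx x]) avg p psi x t ^+ k.+1)).
  by rewrite big_seq1 lerXn2r ?nnegrE ?ltW // (lt_trans lam0).
apply: sum_le_subseq => //; first exact: undup_uniq.
by move=> t; rewrite inE => /eqP ->; rewrite mem_undup map_f.
Qed.

End Probability.

(** * Energy *)

Section Energy.
Variable R : realFieldType.
Implicit Types (f g m : int -> R) (N : nat).

Lemma sqr_sum_le (n : nat) (F : 'I_n -> R) :
  (\sum_i F i) ^+ 2 <= n%:R * \sum_i F i ^+ 2.
Proof.
elim: n F => [|[|n] IH] F; first by rewrite !big_ord0 expr2 mulr0.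
  by rewrite !big_ord_recl !big_ord0 !addr0 mul1r.
rewrite big_ord_recl [X in _ <= _ * X]big_ord_recl.
set S := \sum_(i < _) _; set Q := \sum_(i < _) _.
have := IH (fun i => F (lift ord0 i)); rewrite -/S -/Q => SQ.
have k0 : 0 < n.+1%:R :> R by rewrite ltr0n.
set x := F ord0; rewrite -[n.+2%:R]natr1.
move: SQ k0; set k : R := n.+1%:R => SQ k0.
have h : 0 <= Q + k * x ^+ 2 - 2 * S * x.
  rewrite -(pmulr_rge0 _ k0); have := sqr_ge0 (S - k * x); nra.
nra.
Qed.

Definition increment (x : int) g : int -> R := fun t => (g t - g (t + x)) ^+ 2.

(** Telescoping into [j] increments, then Cauchy-Schwarz. *)
Lemma mass_le_increment_mul x g c (j : nat) :
  mass_le (increment x g) c -> mass_le (increment (j%:Z * x) g) (j%:R ^+ 2 * c).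
Proof.
move=> gc.
have tele t : g t - g (t + j%:Z * x) =
    \sum_(i < j) (g (t + i%:Z * x) - g (t + i%:Z * x + x)).
  elim: j => [|j IH]; first by rewrite big_ord0 mul0r addr0 subrr.
  rewrite big_ord_recr /= -IH; set u := g (t + j%:Z * x).
  have -> : t + (j.+1)%:Z * x = t + j%:Z * x + x by rewrite intS; ring.
  by ring.
have -> : j%:R ^+ 2 * c = j%:R * \sum_(i < j) c.
  by rewrite sumr_const card_ord -(mulr_natl c) mulrA expr2.
have cs : mass_le (fun t => j%:R * \sum_(i < j) increment x g (t + i%:Z * x))
    (j%:R * \sum_(i < j) c).
  apply: mass_leZ; first exact: ler0n.
  by apply: mass_le_sum => i; apply: (mass_le_shift (i%:Z * x) gc).
apply: mass_le_mono cs => t; rewrite {1}/increment tele.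
by have := sqr_sum_le (fun i : 'I_j => g (t + i%:Z * x) - g (t + i%:Z * x + x)).
Qed.

(** Both [g t] and [g (t + (x - y))] are compared with [g (t + x)]. *)
Lemma increment_sub x y g c : mass_le (increment x g) c ->
  mass_le (increment y g) c -> mass_le (increment (x - y) g) (4 * c).
Proof.
move=> gx gy.
have -> : 4 * c = 2 * c + 2 * c by ring.
have := mass_leD (mass_leZ (ler0n _ 2) gx) (mass_le_shift (x - y) (mass_leZ (ler0n _ 2) gy)).
apply: mass_le_mono => t; rewrite /increment.
have -> : t + (x - y) + y = t + x by ring.
have := sqr_ge0 (g t - g (t + x) + (g (t + (x - y)) - g (t + x))).
nra.
Qed.

Definition imass N f : int -> R := fun t => \sum_(r < N) f (t + r%:Z).

(** A trace of the disjointness of translated intervals which, unlike disjointness itself, passes to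
    averages. *)
Definition spread N m := forall t x (l : nat), (N <= `|x|)%N ->
  \sum_(j < l) m (t + j%:Z * x) <= 1.

(** Windows of length [N] translated by distinct multiples of [x] are disjoint, so the double sum
    runs over distinct integers. *)
Lemma spread_imass N f :
  (forall t, 0 <= f t) -> mass_le f 1 -> spread N (imass N f).
Proof.
move=> f0 f1 t x l Nx; rewrite /imass pair_big /=.
rewrite -(big_map (fun jr : 'I_l * 'I_N => t + jr.1%:Z * x + jr.2%:Z) xpredT f).
apply: f1; rewrite map_inj_uniq ?index_enum_uniq // => -[j r] [j' r'] /= e.
have rN := ltn_ord r; have rN' := ltn_ord r'.
have jj : nat_of_ord j = nat_of_ord j'.
  have e' : (j%:Z - j'%:Z) * x = r'%:Z - r%:Z by lia.
  have : (`|(j%:Z - j'%:Z)|%N * `|x|%N < N)%N by rewrite -abszM e'; lia.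
  case: (posnP `|(j%:Z - j'%:Z)|%N) => [|pos]; first by lia.
  move=> lt; have : (`|x| <= `|(j%:Z - j'%:Z)| * `|x|)%N by rewrite leq_pmull.
  by move=> /leq_ltn_trans/(_ lt); lia.
have rr : nat_of_ord r = nat_of_ord r' by rewrite jj in e; lia.
by congr pair; apply: val_inj.
Qed.

Lemma mass_le_imass N f : mass_le f 1 -> mass_le (imass N f) N%:R.
Proof.
move=> f1; have := mass_le_sum (index_enum 'I_N) (fun r => mass_le_shift r%:Z f1).
by rewrite sumr_const card_ord.
Qed.

Lemma imass_ge0 N f : (forall t, 0 <= f t) -> forall t, 0 <= imass N f t.
Proof. by move=> f0 t; apply: sumr_ge0. Qed.

Lemma imass_avg (p : R) N f xs t : imass N (avg p f xs) t = avg p (imass N f) xs t.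
Proof. by rewrite avg_sum; apply: eq_bigr => r _; rewrite avg_shift. Qed.

(** The window at [t] lies in the union of two adjacent windows, the first starting at [t - r]. *)
Lemma imass_cover N f (r : nat) t : (forall t, 0 <= f t) -> (r <= N)%N ->
  imass N f t <= imass N f (t - r%:Z) + imass N f (t - r%:Z + N%:Z).
Proof.
move=> f0 rN; pose F i := f (t - r%:Z + i%:Z).
have shiftF k : \sum_(k <= i < N + k) F i = \sum_(i < N) F (i + k)%N.
  by rewrite -{1}[k]add0n big_addn addnK big_mkord.
have -> : imass N f t = \sum_(r <= i < N + r) F i.
  by rewrite shiftF; apply: eq_bigr => i _; congr f; lia.
have -> : imass N f (t - r%:Z) = \sum_(0 <= i < N) F i by rewrite big_mkord.
have -> : imass N f (t - r%:Z + N%:Z) = \sum_(N <= i < N + N) F i.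
  by rewrite shiftF; apply: eq_bigr => i _; congr f; lia.
rewrite -big_cat_nat ?leq_addl //=.
rewrite [leRHS](@big_cat_nat _ _ _ r) ?leq_addr //=; last by lia.
rewrite [X in _ <= _ + X](@big_cat_nat _ _ _ (N + r)) //=; [|lia|lia].
by rewrite addrCA lerDl; apply: addr_ge0; apply: sumr_ge0 => i _; apply: f0.
Qed.

(* Averaging m t ^+ 2 = m t * m (t + j x) + error over j < l, the spread
   condition bounds the main term by N / l. *)
Lemma energy_le N m x (l : nat) d : (0 < l)%N -> (N <= `|x|)%N ->
  (forall t, 0 <= m t) -> spread N m -> mass_le m N%:R ->
  mass_le (increment x m) d ->
  mass_le (fun t => m t ^+ 2) (N%:R / l%:R + l%:R ^+ 2 * d / 2).
Proof.
move=> l0 Nx m0 spm mN md s us.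
have d0 := mass_le_ge0 md.
pose s2 := undup (s ++ [seq t - j%:Z * x | t <- s, j <- iota 0 l]).
have us2 : uniq s2 by apply: undup_uniq.
have l0' : 0 < l%:R :> R by rewrite ltr0n.
have ssum (j : 'I_l) : 2 * \sum_(t <- s) m t ^+ 2 <=
    2 * (\sum_(t <- s2) m t * m (t + j%:Z * x)) + l%:R ^+ 2 * d.
  have h1 : \sum_(t <- s) m t ^+ 2 <= \sum_(t <- s2) m t ^+ 2.
    apply: sum_le_subseq => // t ts; last exact: sqr_ge0.
    by rewrite mem_undup mem_cat ts.
  have h2 : \sum_(t <- s) m t ^+ 2 <= \sum_(t <- s2) m (t + j%:Z * x) ^+ 2.
    apply: (sum_le_inj (phi := fun t => t - j%:Z * x)) => //.
    - by move=> t t' _ _ /addIr.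
    - move=> t ts; rewrite mem_undup mem_cat; apply/orP; right.
      by apply/allpairsP; exists (t, nat_of_ord j); rewrite mem_iota ltn_ord.
    - by move=> t ts; rewrite subrK.
    - by move=> t _; apply: sqr_ge0.
  have h3 : \sum_(t <- s2) increment (j%:Z * x) m t <= l%:R ^+ 2 * d.
    apply: le_trans (mass_le_increment_mul j md us2) _.
    by rewrite ler_wpM2r // lerXn2r ?nnegrE ?ler0n // ler_nat ltnW.
  have h4 : \sum_(t <- s2) m t ^+ 2 + \sum_(t <- s2) m (t + j%:Z * x) ^+ 2 =
     2 * (\sum_(t <- s2) m t * m (t + j%:Z * x))
     + \sum_(t <- s2) increment (j%:Z * x) m t.
    rewrite big_distrr -!big_split /=; apply: eq_bigr => t _.
    by rewrite /increment; ring.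
  lra.
have : \sum_(j < l) (2 * \sum_(t <- s) m t ^+ 2) <= \sum_(j < l)
    (2 * (\sum_(t <- s2) m t * m (t + j%:Z * x)) + l%:R ^+ 2 * d).
  by apply: ler_sum => j _.
rewrite sumr_const card_ord big_split /= -big_distrr /= exchange_big /= sumr_const card_ord.
have cross : \sum_(t <- s2) \sum_(j < l) m t * m (t + j%:Z * x) <= N%:R.
  apply: le_trans (mN _ us2); apply: ler_sum => t _.
  by rewrite -big_distrr /= -[leRHS]mulr1 ler_wpM2l // spm.
move=> tot; rewrite -[leLHS]mulr_natl -[X in _ <= _ + X]mulr_natl in tot.
rewrite -(ler_pM2l l0').
have -> : l%:R * (N%:R / l%:R + l%:R ^+ 2 * d / 2) = N%:R + l%:R ^+ 3 * d / 2.
  by field; rewrite gt_eqF.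
move: cross tot; set A := \sum_(t <- s2) _; set B := \sum_(t <- s) _ => cross tot.
have e : l%:R * (l%:R ^+ 2 * d) = l%:R ^+ 3 * d :> R by ring.
nra.
Qed.

End Energy.

(** * Littlewood-Offord bound *)

Section LittlewoodOfford.
Variables (R : rcfType) (p : R) (N : nat).
Hypotheses (p_gt0 : 0 < p) (p_le12 : p <= 1 / 2) (N_gt0 : (0 < N)%N).
Implicit Types (f g m : int -> R).

Definition lo_const : R := 4 / Num.sqrt (p * (1 - p)).

Lemma spread_avg m xs : spread N m -> spread N (avg p m xs).
Proof.
have [h0 h1] := (p_gt0, p_le12).
move=> spm; apply: (avg_ind (Q := spread N)) => // x _ g spg t y l Ny.
rewrite /step big_split -!big_distrr /=.
under [X in _ + p * X]eq_bigr do rewrite addrAC.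
have := spg t y l Ny; have := spg (t + x) y l Ny.
move: (\sum_(j < l) _) (\sum_(j < l) _) => u w; nra.
Qed.

(** Induction with a dichotomy at each step: if the increments along [x] are small, [energy_le]
    gives the target directly; otherwise [energy_decrement] lowers the energy enough to pass from
    [1 / sqrt (i + 1)] to [1 / sqrt (i + 2)]. *)
Lemma energy_decay m xs : (forall t, 0 <= m t) -> spread N m ->
  mass_le m N%:R -> {in xs, forall x, (N <= `|x|)%N} ->
  mass_le (fun t => avg p m xs t ^+ 2)
    (N%:R * (lo_const / Num.sqrt (size xs).+1%:R)).
Proof.
have [h0 h1] := (p_gt0, p_le12).
move=> m0 spm mN; set P := p * (1 - p).
have P0 : 0 < P by rewrite /P; nra.
have P1 : P <= 1 by rewrite /P; nra.
have q0 : 0 <= p by lra.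
have q1 : p <= 1 by lra.
have q2 : 0 < 1 - p by lra.
have sP : 0 < Num.sqrt P by rewrite sqrtr_gt0.
have C0 : 0 < lo_const by rewrite divr_gt0 //; lra.
have N0 : 0 < N%:R :> R by rewrite ltr0n.
have trivial_bound ys : mass_le (fun t => avg p m ys t ^+ 2) N%:R.
  apply: mass_le_avg_sqr => //; rewrite -[N%:R]mul1r; apply: mass_le_sqr => // t.
  rewrite m0 /=; have := spm t N%:Z 1%N (leqnn _).
  by rewrite big_ord1 mul0r addr0.
elim/last_ind: xs => [|xs x IH] Nxs.
  apply: mass_leW (trivial_bound [::]); rewrite sqrtr1 divr1.
  rewrite -[leLHS]mulr1 (ler_wpM2l (ltW N0)) // /lo_const ler_pdivlMr // mul1r.
  apply: (@le_trans _ _ 1); last by lra.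
  by rewrite -[leRHS](@sqrtr1 R) ler_wsqrtr.
rewrite size_rcons; set i := size xs in IH *.
have {}IH : mass_le (fun t => avg p m xs t ^+ 2)
    (N%:R * (lo_const / Num.sqrt i.+1%:R)).
  by apply: IH => y yxs; apply: Nxs; rewrite mem_rcons inE yxs orbT.
have Nx : (N <= `|x|)%N by apply: Nxs; rewrite mem_rcons mem_head.
set v := N%:R * (lo_const / Num.sqrt i.+2%:R).
have sj : 0 < Num.sqrt i.+2%:R :> R by rewrite sqrtr_gt0 ltr0n.
(* In the first case the target exceeds the trivial bound [N]. *)
have [small|large] := ltP (P * i.+2%:R) 1.
  apply: mass_leW (trivial_bound (rcons xs x)).
  rewrite /v -[leLHS]mulr1 (ler_wpM2l (ltW N0)) // /lo_const -mulrA -invfM.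
  rewrite -sqrtrM ?(ltW P0) // -/P ler_pdivlMr ?sqrtr_gt0 ?mulr_gt0 ?ltr0n //.
  rewrite mul1r.
  apply: (@le_trans _ _ 1); last by lra.
  by rewrite -[leRHS](@sqrtr1 R) ler_wsqrtr // ltW.
set w := Num.sqrt (P * i.+2%:R).
have w1 : 1 <= w by rewrite /w -[leLHS](@sqrtr1 R) ler_wsqrtr.
have w2 : w ^+ 2 = P * i.+2%:R by rewrite sqr_sqrtr // mulr_ge0 ?ltr0n ?ler0n // ltW.
(* The number [l] of translates is the integer part of [w]. *)
have [l l1 /andP[l2 w2l]] : exists2 l : nat, (0 < l)%N &
    (l%:R ^+ 2 <= P * i.+2%:R) && (w <= 2 * l%:R).
  have ex : exists l : nat, l%:R ^+ 2 <= P * i.+2%:R :> R.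
    by exists 1%N; rewrite expr1n.
  have bnd (l : nat) : l%:R ^+ 2 <= P * i.+2%:R :> R -> (l <= i.+2)%N.
    move=> l2; rewrite -(ler_nat R); apply: (@le_trans _ _ (l%:R ^+ 2)).
      by rewrite -natrX ler_nat; case: (l) => // k; rewrite expnS expn1 leq_pmulr.
    apply: le_trans l2 _; rewrite -[leRHS]mul1r ler_wpM2r //.
  case: (ex_maxnP ex bnd) => l l2 lmax; exists l.
    by apply: lmax; rewrite expr1n.
  rewrite l2 /=; have lw : P * i.+2%:R < l.+1%:R ^+ 2.
    by rewrite ltNge; apply/negP => /lmax; rewrite ltnn.
  have : 1 <= l%:R :> R by rewrite ler1n; apply: lmax; rewrite expr1n.
  move: lw; rewrite -[l.+1%:R]natr1 -w2; move: w1 => w1'; nra.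
have l1' : 1 <= l%:R :> R by rewrite ler1n.
have vE : v = N%:R * (4 / w).
  by rewrite /v /lo_const /w -mulrA -invfM -sqrtrM // ltW.
have v0 : 0 < v by rewrite vE mulr_gt0 // divr_gt0 //; lra.
(* With this threshold the error term of [energy_le] is [v / 2], while larger increments lower the
   energy by [P * v / l^2], at least [v / (i + 2)]. *)
pose d := v / l%:R ^+ 2.
rewrite -cats1 avg_cat /=.
have [flat|nflat] := pselect (mass_le (increment x (avg p m xs)) d).
  have := energy_le l1 Nx (avg_ge0 q0 q1 xs m0) (spread_avg xs spm)
    (mass_le_avg q0 q1 xs mN) flat.
  move=> /(mass_le_avg_sqr q0 q1 [:: x]) /=; apply: mass_leW.
  have -> : l%:R ^+ 2 * d = v by rewrite /d; field; rewrite gt_eqF //; lra.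
  suff : N%:R / l%:R <= v / 2 by lra.
  rewrite vE ler_pdivrMr; last by lra.
  have -> : N%:R * (4 / w) / 2 * l%:R = N%:R * (2 * l%:R / w).
    by field; rewrite gt_eqF //; lra.
  rewrite -[leLHS]mulr1 (ler_wpM2l (ltW N0)) // ler_pdivlMr; first by rewrite mul1r.
  by lra.
apply: mass_leW (energy_decrement q0 q1 IH nflat).
rewrite -/P /d lerBlDr.
set j : R := i.+2%:R in l2 *.
have j2 : 2 <= j by rewrite /j (ler_nat R 2).
have jE : i.+1%:R = j - 1 by rewrite /j -[i.+2%:R]natr1 addrK.
have Pl : j^-1 <= P / l%:R ^+ 2.
  rewrite ler_pdivlMr; last by rewrite exprn_gt0 //; lra.
  by rewrite mulrC ler_pdivrMr //; lra.
apply: (@le_trans _ _ (v * (1 + j^-1))); last first.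
  by rewrite mulrDr mulr1 lerD2l mulrCA (ler_wpM2l (ltW v0)).
(* What remains amounts to [j^3 <= (j - 1) * (j + 1)^2], true for [j >= 2]. *)
rewrite /v -mulrA (ler_wpM2l (ltW N0)) // -mulrA (ler_wpM2l (ltW C0)) //.
rewrite jE; set s1 := Num.sqrt (j - 1); set s2 := Num.sqrt j.
have s10 : 0 < s1 by rewrite sqrtr_gt0; lra.
have s1E : s1 ^+ 2 = j - 1 by rewrite sqr_sqrtr //; lra.
have s2E : s2 ^+ 2 = j by rewrite sqr_sqrtr //; lra.
have s20 : 0 < s2 by rewrite sqrtr_gt0; lra.
rewrite -(ler_pM2l s10) mulfV ?gt_eqF // -(ler_pM2l s20) mulr1.
have -> : s2 * (s1 * (s2^-1 * (1 + j^-1))) = s1 * (1 + j^-1).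
  by field; rewrite !gt_eqF //; lra.
have ji : 0 <= j^-1 by rewrite invr_ge0; lra.
have sj1 : 0 <= s1 * (1 + j^-1) by rewrite mulr_ge0 ?addr_ge0 ?(ltW s10).
rewrite -ler_sqr ?nnegrE ?(ltW s20) //.
rewrite exprMn s1E s2E -(ler_pM2r (x := j ^+ 2)); last by rewrite exprn_gt0; lra.
have -> : (j - 1) * (1 + j^-1) ^+ 2 * j ^+ 2 = (j - 1) * (j + 1) ^+ 2.
  by field; rewrite gt_eqF; lra.
nra.
Qed.

Let delta0 : int -> R := fun u => (u == 0)%:R.

(* L2 x L2 duality: the average over ys pairs the function averaged over xs with
   the law of the random sum over ys, both of energy O(N / sqrt k) at scale N. *)
Lemma littlewood_offord f xs ys (k : nat) : (forall t, 0 <= f t) -> mass_le f 1 ->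
  size xs = k -> size ys = k ->
  {in xs, forall x, (N <= `|x|)%N} -> {in ys, forall x, (N <= `|x|)%N} ->
  forall t, imass N (avg p f (xs ++ ys)) t <= 2 * lo_const / Num.sqrt k.+1%:R.
Proof.
have [h0 h1] := (p_gt0, p_le12).
have q0 : 0 <= p by lra.
have q1 : p <= 1 by lra.
move=> f0 f1 sxs sys Nxs Nys t.
set m := imass N f.
have m0 := imass_ge0 N f0; rewrite -/m in m0.
pose a := avg p m xs.
have a0 u : 0 <= a u by apply: avg_ge0.
have ea : mass_le (fun u => a u ^+ 2) (N%:R * (lo_const / Num.sqrt k.+1%:R)).
  rewrite -sxs; apply: energy_decay => //.
    exact: spread_imass.
  exact: mass_le_imass.
have d0 u : 0 <= delta0 u by apply: ler0n.
have d1 : mass_le delta0 1.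
  move=> s us; rewrite /delta0; have [s0|ns0] := boolP (0 \in s).
    rewrite (bigD1_seq (0 : int)) //= ?eqxx big1 ?addr0 ?lexx // => u u0.
    by rewrite (negPf u0).
  rewrite big1_seq ?ler01 // => u /andP[_ us']; case: eqP => // u0.
  by rewrite -u0 us' in ns0.
(* This is [N] times the law of the random sum over [ys] minus a uniform integer in [[0, N)]. *)
pose b := avg p (imass N delta0) (map -%R ys).
have b0 u : 0 <= b u by apply: avg_ge0 => //; apply: imass_ge0.
have eb : mass_le (fun u => b u ^+ 2) (N%:R * (lo_const / Num.sqrt k.+1%:R)).
  rewrite -sys -(size_map -%R ys); apply: energy_decay.
  - exact: imass_ge0.
  - exact: spread_imass.
  - exact: mass_le_imass.
  - by move=> _ /mapP[y yys ->]; rewrite abszN; apply: Nys.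
pose G u := a (t + u) + a (t + u + N%:Z).
have G0 u : 0 <= G u by apply: addr_ge0.
pose W := undup [seq dot v ys - (r : nat)%:Z | v <- bits k, r <- iota 0 N].
have uW : uniq W by apply: undup_uniq.
(* The covering by two adjacent windows, summed over all offsets [r < N]. *)
have cover u : N%:R * a (t + u) <= \sum_(r < N) G (u - r%:Z).
  rewrite mulr_natl -[N in X in X <= _]card_ord -sumr_const; apply: ler_sum => r _.
  rewrite /G !addrA /a.
  have -> : avg p m xs (t + u - r%:Z + N%:Z) =
    avg p (fun w => m (w + (N%:Z - r%:Z))) xs (t + u).
    by rewrite avg_shift; congr (avg _ _ _ _); lia.
  have -> : avg p m xs (t + u - r%:Z) = avg p (fun w => m (w - r%:Z)) xs (t + u).
    by rewrite avg_shift.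
  rewrite -avgD; apply: avg_mono => // w.
  have -> : w + (N%:Z - r%:Z) = w - r%:Z + N%:Z by lia.
  by apply: imass_cover => //; apply/ltnW/ltn_ord.
have pick u : u \in W -> G u = \sum_(w <- W) G w * delta0 (w - u).
  move=> uWu; rewrite (bigD1_seq u) //= subrr /delta0 eqxx mulr1.
  rewrite big1 ?addr0 // => w wu.
  by rewrite subr_eq0 (negPf wu) mulr0.
have main : N%:R * avg p a ys t <= \sum_(w <- W) G w * b w.
  have -> : \sum_(w <- W) G w * b w =
     \sum_(v <- bits k) bern p v * \sum_(r < N) G (dot v ys - r%:Z).
    have -> : \sum_(v <- bits k) bern p v * \sum_(r < N) G (dot v ys - r%:Z) =
      \sum_(v <- bits k) \sum_(w <- W) G w * (bern p v * imass N delta0 (w - dot v ys)).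
      apply: eq_big_seq => v vk.
      under [RHS]eq_bigr do rewrite mulrCA.
      rewrite -big_distrr /=; congr (_ * _).
      under [RHS]eq_bigr do rewrite /imass big_distrr /=.
      rewrite exchange_big /=; apply: eq_bigr => r _.
      rewrite pick; last first.
        rewrite mem_undup; apply/allpairsP; exists (v, nat_of_ord r).
        by rewrite mem_iota ltn_ord.
      by apply: eq_bigr => w _; congr (_ * delta0 _); lia.
    rewrite exchange_big /=; apply: eq_bigr => w _.
    rewrite -big_distrr /= /b avg_bern size_map sys; congr (_ * _).
    by apply: eq_bigr => v _; rewrite dotN.
  rewrite avg_bern sys big_distrr /=; apply: ler_sum => v _.
  by rewrite mulrCA ler_wpM2l ?bern_ge0.
rewrite imass_avg avg_cat -/m -/a.
have N0 : 0 < N%:R :> R by rewrite ltr0n.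
rewrite -(ler_pM2l N0); apply: le_trans main _.
have ea1 := mass_le_shift t ea; have ea2 := mass_le_shift (t + N%:Z) ea.
set E := N%:R * (lo_const / _) in ea eb ea1 ea2.
have -> : N%:R * (2 * lo_const / Num.sqrt k.+1%:R) = (E + E) / 2 + E.
  by rewrite /E; lra.
(* Since [(x + y) * z <= (x^2 + y^2) / 2 + z^2], the pairing is bounded by energies. *)
have := mass_leD (mass_leZ _ (mass_leD ea1 ea2)) eb.
move=> /(_ 2^-1); rewrite invr_ge0 ler0n => /(_ isT W uW).
rewrite [2^-1 * _]mulrC; apply: le_trans; apply: ler_sum => w _; rewrite /G.
rewrite [t + w]addrC -[w + t + _]addrA.
have := sqr_ge0 (a (w + t) - b w); have := sqr_ge0 (a (w + (t + N%:Z)) - b w).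
move: (a _) (a _) (b w) => x y z; lra.
Qed.

End LittlewoodOfford.

(** * Decrement of the energy *)

(* The property of the A_i used against arithmetic structure: the set of all
   x + j with x in B and 0 <= j <= N is at most twice as large as B. *)
Definition thick (N : nat) (B : seq int) : Prop :=
  [/\ uniq B, (2 * N <= size B)%N &
    exists2 E : seq int, (size E <= 2 * size B)%N &
      forall x (j : nat), x \in B -> (j <= N)%N -> x + j%:Z \in E].

Section Flat.
Variable R : realFieldType.
Implicit Types (g e : int -> R) (B : seq int).

(* Pigeonhole: the r + 1 translates by multiples of y of the set of good shifts
   all lie in E, so two of them meet and j y is a difference of good shifts. *)
Lemma flat_multiple N B g (c rho : R) (r y : nat) :
  thick N B -> (r * y <= N)%N -> (0 < N)%N -> 2 < r.+1%:R * rho ->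
  rho * (size B)%:R <= \sum_(x <- B) (`[< mass_le (increment x g) c >])%:R ->
  exists2 j : nat, (0 < j <= r)%N & mass_le (increment (j%:Z * y%:Z) g) (4 * c).
Proof.
move=> [uB NB [E sE EB]] ryN N0 rho2 dens.
apply: contrapT => nex.
pose L := [seq x <- B | `[< mass_le (increment x g) c >]].
have sL : rho * (size B)%:R <= (size L)%:R.
  apply: le_trans dens _; rewrite size_filter -sum1_count natr_sum [leRHS]big_mkcond /=.
  by apply: ler_sum => x _; case: asbool.
have LB x : x \in L -> x \in B /\ mass_le (increment x g) c.
  by rewrite mem_filter => /andP[/asboolP ? ?].
have Ldiff x x' (d : nat) : x \in L -> x' \in L -> (0 < d <= r)%N ->
    x - x' = d%:Z * y%:Z -> False.
  move=> /LB[_ lx] /LB[_ lx'] dr e; apply: nex; exists d => //.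
  by rewrite -e; apply: increment_sub.
have uA : uniq [seq x + (i * y)%N%:Z | i <- iota 0 r.+1, x <- L].
  apply: allpairs_uniq; [exact: iota_uniq | exact: filter_uniq |].
  move=> u u1 /allpairsP[z [zi zL ->]] /allpairsP[z1 [zi1 zL1 ->]].
  case: z z1 zi zL zi1 zL1 => [i x] [i' x'] ir xL ir' xL' /= e.
  rewrite mem_iota /= add0n ltnS in ir; rewrite mem_iota /= add0n ltnS in ir'.
  have [lt|lt|ii] := ltngtP i i'.
  - exfalso; apply: (Ldiff x x' (i' - i)%N) => //; first by lia.
    by rewrite -subzn ?(ltnW lt) // mulrBl; lia.
  - exfalso; apply: (Ldiff x' x (i - i')%N) => //; first by lia.
    by rewrite -subzn ?(ltnW lt) // mulrBl; lia.
  - by move: e; rewrite ii => e; have -> : x = x' by lia.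
have : (size [seq (x + (i * y)%N%:Z)%R | i <- iota 0 r.+1, x <- L] <= size E)%N.
  apply: uniq_leq_size => // u /allpairsP[[i x] [ir /LB[xB _] ->]].
  apply: EB => //; rewrite mem_iota /= add0n ltnS in ir.
  by apply: leq_trans ryN; rewrite leq_mul2r ir orbT.
rewrite size_allpairs size_iota => le1.
have : (r.+1 * size L)%:R <= (2 * size B)%:R :> R by rewrite ler_nat (leq_trans le1).
rewrite !natrM => le2.
have B0 : 0 < (size B)%:R :> R by rewrite ltr0n; lia.
have r0 : 0 < r.+1%:R :> R by rewrite ltr0n.
move: sL le2 B0 r0 rho2; move: (size B)%:R (size L)%:R (r.+1%:R) => b l k; nra.
Qed.

(* The factorial makes the multiple of y independent of y. *)
Lemma flat_progression N B g (c rho : R) (r y : nat) :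
  thick N B -> (r * y <= N)%N -> (0 < N)%N -> 2 < r.+1%:R * rho ->
  rho * (size B)%:R <= \sum_(x <- B) (`[< mass_le (increment x g) c >])%:R ->
  mass_le (increment ((r`!)%:Z * y%:Z) g) (4 * (r`!)%:R ^+ 2 * c).
Proof.
move=> tB ryN N0 rho2 dens.
have [j /andP[j0 jr] jc] := flat_multiple tB ryN N0 rho2 dens.
have c0 := mass_le_ge0 jc.
have jd : (j %| r`!)%N by rewrite dvdn_fact ?j0.
have /(mass_le_increment_mul (r`! %/ j)%N) := jc.
rewrite mulrA -PoszM (divnK jd); apply: mass_leW.
have -> : 4 * (r`!)%:R ^+ 2 * c = (r`!)%:R ^+ 2 * (4 * c) by ring.
by rewrite ler_wpM2r // lerXn2r ?nnegrE ?ler0n // ler_nat leq_div.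
Qed.

(** The first term has the desired size when [beta] bounds the mass of windows of length [N]; the
    error [e], small in l2, is left to the moment bound. *)
Definition nearly_flat (N : nat) (beta b D : R) g := exists e,
  [/\ forall t, 0 <= e t <= b, mass_le (fun t => e t ^+ 2) D &
      forall t, g t <= 4 * beta / N%:R + e t].

(** The invariants kept by averaging. The last one carries the Lipschitz condition, with
    [a = 2 ^ eta]. *)
Definition regular (N : nat) (beta b a : R) g :=
  [/\ forall t, 0 <= g t <= b, forall t, imass N g t <= beta &
      forall t, g t <= a * g (t + 1)].

Lemma sum_blocks (F : nat -> R) (q k : nat) :
  \sum_(y < k) \sum_(j < q) F (q * y + j)%N = \sum_(0 <= i < q * k) F i.
Proof.
elim: k => [|k IH]; first by rewrite big_ord0 muln0 big_geq.
have last_block : \sum_(q * k <= i < q + q * k) F i = \sum_(j < q) F (q * k + j)%N.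
  rewrite -{1}[(q * k)%N]add0n big_addn addnK big_mkord.
  by apply: eq_bigr => j _; rewrite addnC.
rewrite big_ord_recr /= IH mulnS -last_block.
by rewrite -big_cat_nat ?leq_addl.
Qed.

(** Let [u] be the mean of [g] along multiples of [q] up to about [N]. As [g t] is at most twice
    [g (t + j)] for [j <= q], [u] is controlled by the mass of a window of length [N]; the error
    [|g - u|] is small in l2 by the bound on increments. *)
Lemma nearly_flat_of_progression (N q r : nat) (beta b a D : R) g :
  (0 < N)%N -> (0 < q)%N -> (r <= q)%N -> 1 <= a -> a ^+ q <= 2 ->
  regular N beta b a g ->
  (forall y : nat, (r * y <= N)%N -> mass_le (increment (q%:Z * y%:Z) g) D) ->
  nearly_flat N beta b D g.
Proof.
move=> N0 q0 rq a1 aq [gb gbeta ga] gD.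
have g0 t : 0 <= g t by have /andP[] := gb t.
have N0' : 0 < N%:R :> R by rewrite ltr0n.
have D0 : 0 <= D by apply: mass_le_ge0 (gD 0%N _); rewrite muln0.
have b0 : 0 <= b by have /andP[+ +] := gb 0; apply: le_trans.
have gpow (j : nat) t : g t <= a ^+ j * g (t + j%:Z).
  elim: j => [|j IH]; first by rewrite mul1r addr0.
  apply: le_trans IH _; rewrite exprSr -mulrA.
  rewrite ler_wpM2l ?exprn_ge0 //; first by lra.
  by have := ga (t + j%:Z); rewrite -addrA -PoszD addn1.
have g2 (j : nat) t : (j <= q)%N -> g t <= 2 * g (t + j%:Z).
  move=> jq; apply: le_trans (gpow j t) _; rewrite ler_wpM2r //.
  by apply: le_trans aq; rewrite ler_weXn2l.
(* If [N < q], the factor 2 covers the whole window and the error is zero. *)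
have [Nq|qN] := ltnP N q.
  exists (fun=> 0); split => [t|s _|t].
  - by rewrite lexx.
  - by rewrite big1 // => t _; rewrite expr2 mul0r.
  - rewrite addr0 ler_pdivlMr // mulrC.
    have : N%:R * g t <= 2 * imass N g t.
      rewrite mulr_natl -[N in X in X <= _]card_ord -sumr_const big_distrr /=.
      apply: ler_sum => j _; apply: g2.
      by apply: leq_trans (ltnW (ltn_ord j)) (ltnW Nq).
    by have := gbeta t; have := imass_ge0 N g0 t; lra.
pose Y := (N %/ q)%N.
have Y0 : (0 < Y)%N by rewrite divn_gt0.
have Y0' : 0 < Y%:R :> R by rewrite ltr0n.
have q0' : 0 < q%:R :> R by rewrite ltr0n.
have YqN : (q * Y <= N)%N by rewrite mulnC leq_divM.
have NYq : N%:R <= 2 * (q%:R * Y%:R) :> R.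
  by rewrite -!natrM ler_nat; have := ltn_ceil N q0; rewrite -/Y; nia.
pose u t := Y%:R^-1 * \sum_(y < Y) g (t + q%:Z * y%:Z).
have u0 t : 0 <= u t by rewrite mulr_ge0 ?invr_ge0 ?(ltW Y0') // sumr_ge0.
have ub t : u t <= b.
  rewrite /u mulrC ler_pdivrMr // mulr_natr -[Y in X in _ <= X]card_ord -sumr_const.
  by apply: ler_sum => y _; have /andP[] := gb (t + q%:Z * y%:Z).
have ubeta t : u t <= 4 * beta / N%:R.
  have S1 : q%:R * \sum_(y < Y) g (t + q%:Z * y%:Z) <= 2 * beta.
    apply: (@le_trans _ _ (2 * imass N g t)); last by rewrite ler_wpM2l.
    apply: (@le_trans _ _ (2 * \sum_(0 <= i < q * Y) g (t + i%:Z))).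
      rewrite -(sum_blocks (fun i => g (t + i%:Z))) !big_distrr /=.
      apply: ler_sum => y _.
      have -> : q%:R * g (t + q%:Z * y%:Z) = \sum_(j < q) g (t + q%:Z * y%:Z).
        by rewrite sumr_const card_ord mulr_natl.
      rewrite big_distrr /=.
      apply: ler_sum => j _.
      have := g2 j (t + q%:Z * y%:Z) (ltnW (ltn_ord j)).
      by rewrite -addrA -PoszM -PoszD.
    rewrite ler_wpM2l // /imass -(big_mkord xpredT (fun i => g (t + i%:Z))).
    by rewrite [leRHS](@big_cat_nat _ _ _ (q * Y)) //= lerDl sumr_ge0.
  rewrite /u ler_pdivlMr // mulrC.
  have beta0 : 0 <= beta by apply: le_trans (imass_ge0 N g0 t) (gbeta t).
  set S := \sum_(y < Y) _ in S1 *.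
  have -> : N%:R * (Y%:R^-1 * S) = (N%:R / (q%:R * Y%:R)) * (q%:R * S).
    by field; rewrite !gt_eqF.
  have qY : N%:R / (q%:R * Y%:R) <= 2 :> R by rewrite ler_pdivrMr ?mulr_gt0.
  have qY0 : 0 <= N%:R / (q%:R * Y%:R) :> R.
    by rewrite divr_ge0 ?mulr_ge0 ?ler0n.
  have S0 : 0 <= q%:R * S by rewrite mulr_ge0 ?ler0n // sumr_ge0.
  move: (N%:R / _) qY qY0 => z qY qY0; nra.
exists (fun t => `|g t - u t|); split => [t||t].
- rewrite normr_ge0 /= ler_norml.
  have /andP[h1 h2] := gb t; have := u0 t; have := ub t; lra.
- have : mass_le (fun t => Y%:R^-1 * \sum_(y < Y) increment (q%:Z * y%:Z) g t)
      (Y%:R^-1 * \sum_(y < Y) D).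
    apply: mass_leZ; first by rewrite invr_ge0 ler0n.
    move=> s us; rewrite exchange_big /=; apply: ler_sum => y _.
    apply: (gD y) us; apply: leq_trans YqN.
    by rewrite leq_mul // ltnW.
  rewrite sumr_const card_ord -(mulr_natl D) mulKf ?gt_eqF //.
  apply: mass_le_mono => t; rewrite real_normK ?num_real //.
  have -> : g t - u t = Y%:R^-1 * \sum_(y < Y) (g t - g (t + q%:Z * y%:Z)).
    rewrite sumrB sumr_const card_ord mulrBr -(mulr_natl (g t)) mulKf ?gt_eqF //.
  rewrite exprMn expr2 -mulrA ler_wpM2l ?invr_ge0 ?ler0n //.
  rewrite mulrC ler_pdivrMr // mulrC.
  by have := sqr_sum_le (fun y : 'I_Y => g t - g (t + q%:Z * y%:Z)).
- have := ubeta t; have := ler_norm (g t - u t); lra.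
Qed.

Variable p : R.
Hypotheses (p_gt0 : 0 < p) (p_lt1 : p < 1).

Lemma nearly_flat_avg N beta b D g xs :
  nearly_flat N beta b D g -> nearly_flat N beta b D (avg p g xs).
Proof.
have [h0 h1] := (ltW p_gt0, ltW p_lt1).
move=> [e [eb eD ge]]; exists (avg p e xs); split => [t||t].
- by rewrite avg_ge0 ?avg_le // => u; have /andP[] := eb u.
- exact: mass_le_avg_sqr.
- rewrite -[X in _ <= X + _](avg_cst p _ xs t) -avgD.
  exact: avg_mono.
Qed.

Lemma regular_avg N beta b a g xs :
  regular N beta b a g -> regular N beta b a (avg p g xs).
Proof.
have [h0 h1] := (ltW p_gt0, ltW p_lt1).
move=> [gb gbeta ga]; split => t.
- by rewrite avg_ge0 ?avg_le // => u; have /andP[] := gb u.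
- by rewrite imass_avg; apply: avg_le.
- by rewrite -avg_shift -avgZ; apply: avg_mono.
Qed.

(* Either some intermediate function is nearly constant along most of the next
   set, and then it is nearly flat; or every step, outside an event of
   conditional probability sigma^2, lowers the energy by p(1-p)c, which can
   happen at most j times. *)
Lemma prob_not_nearly_flat N (r j : nat) (beta b a c sigma : R) g (Bs : seq (seq int)) :
  (0 < N)%N -> (0 < r)%N -> 1 <= a -> a ^+ r`! <= 2 -> 0 < c ->
  0 < sigma <= 1 -> 2 < r.+1%:R * sigma ^+ 2 ->
  (forall B, B \in Bs -> thick N B) -> regular N beta b a g ->
  mass_le (fun t => g t ^+ 2) (j%:R * (p * (1 - p) * c)) ->
  prob_le Bs (fun x => ~ nearly_flat N beta b (4 * (r`!)%:R ^+ 2 * c) (avg p g x))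
    (((1 + sigma) * sigma) ^+ size Bs / sigma ^+ j).
Proof.
have [h0 h1] := (ltW p_gt0, ltW p_lt1).
move=> N0 r0 a1 aq c0 /andP[s0 s1] rs.
have P0 : 0 < p * (1 - p) * c by rewrite mulr_gt0 // mulr_gt0 // subr_gt0.
have q0 : 0 <= (1 + sigma) * sigma by rewrite mulr_ge0 ?addr_ge0 ?ltW.
have sg (k : nat) : 0 < sigma ^+ k by rewrite exprn_gt0.
elim: Bs g j => [|B Bs IH] g j tB regg gj.
  (* With no step left, the claimed bound is at least 1. *)
  apply: prob_leW (prob_le1 _ _ _); rewrite expr0 div1r invf_ge1 //.
  exact: exprn_ile1 (ltW s0) s1.
have tB0 : thick N B by apply: tB; rewrite mem_head.
have tBs B' : B' \in Bs -> thick N B' by move=> h; apply: tB; rewrite inE h orbT.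
set lucky := fun x => `[< mass_le (increment x g) c >].
have [flat|nflat] := leP (sigma ^+ 2 * (size B)%:R) (\sum_(x <- B) (lucky x)%:R).
  apply: prob_le_false => [|w _]; first by rewrite divr_ge0 ?exprn_ge0 ?(ltW s0).
  apply; apply: nearly_flat_avg.
  apply: (nearly_flat_of_progression (q := r`!) (r := r) (a := a)) => //.
  - exact: fact_gt0.
  - by case: (r) r0 => // k _; rewrite factS leq_pmulr // fact_gt0.
  - by move=> y ryN; apply: (flat_progression tB0 ryN N0 rs flat).
set Z := ((1 + sigma) * sigma) ^+ size Bs / sigma ^+ j.
have Z0 : 0 <= Z by rewrite divr_ge0 ?exprn_ge0 ?(ltW s0).
have each x : x \in B -> prob_le Bs
    (fun w => ~ nearly_flat N beta b (4 * (r`!)%:R ^+ 2 * c) (avg p (step p x g) w))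
    (Z * (sigma + (lucky x)%:R)).
  move=> xB; have regx := regular_avg [:: x] regg.
  rewrite /lucky; case: asboolP => lx.
    apply: (@prob_leW _ _ _ Z); first by rewrite -[leLHS]mulr1 ler_wpM2l ?lerDr ?(ltW s0).
    by apply: IH => //; apply: (mass_le_avg_sqr h0 h1 [:: x] gj).
  have gx := energy_decrement h0 h1 gj lx.
  (* For [j = 0] a decrement would make the energy negative. *)
  case: j gj @Z Z0 gx => [|j] gj Z Z0 gx.
    by exfalso; have := mass_le_ge0 gx; rewrite mul0r sub0r; lra.
  have -> : Z * (sigma + 0) = ((1 + sigma) * sigma) ^+ size Bs / sigma ^+ j.
    by rewrite /Z addr0 exprSr invfM mulrA divfK // gt_eqF.
  apply: IH => //; apply: mass_leW gx.
  by rewrite -natr1 mulrDl mul1r addrK.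
rewrite /prob_le sum_words_cons.
apply: (@le_trans _ _ (\sum_(x <- B)
    Z * (sigma + (lucky x)%:R) * (size (words Bs))%:R)).
  by apply: ler_sum_in => x xB; apply: each.
rewrite -big_distrl -big_distrr /= big_split /= sum_const_seq.
rewrite /= size_allpairs natrM exprS -/(words Bs).
set W := (size (words Bs))%:R; have W0 : 0 <= W by apply: ler0n.
(* Lucky shifts have density below [sigma ^+ 2] here, so the mean of the factors [sigma + lucky] is
   at most [sigma + sigma ^+ 2]. *)
have -> : (1 + sigma) * sigma * ((1 + sigma) * sigma) ^+ size Bs / sigma ^+ j *
   ((size B)%:R * W) = Z * ((size B)%:R * sigma + sigma ^+ 2 * (size B)%:R) * W.
  by rewrite /Z; ring.
rewrite ler_wpM2r // ler_wpM2l // lerD2l; exact: ltW.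
Qed.

End Flat.

(** * Improving the supremum bound *)

(** Follows from the Bernoulli-type inequality [(1 + p * s) * (1 - p)^s <= 1]. *)
Lemma mulrn_exp1p_le (R : realFieldType) (p : R) (s : nat) :
  0 <= p <= 1 -> p * s%:R * (1 - p) ^+ s <= 1.
Proof.
move=> /andP[p0 p1].
suff : (1 + p * s%:R) * (1 - p) ^+ s <= 1.
  have : 0 <= (1 - p) ^+ s by rewrite exprn_ge0 // subr_ge0.
  by rewrite mulrDl mul1r; lra.
elim: s => [|s IH]; first by rewrite mulr0 addr0 mul1r.
apply: le_trans IH; rewrite exprS mulrA ler_wpM2r ?exprn_ge0 ?subr_ge0 //.
rewrite -natr1; have : 0 <= s%:R :> R by rewrite ler0n.
nra.
Qed.

Section Round.
Variables (R : realFieldType) (p : R).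
Hypotheses (p_gt0 : 0 < p) (p_le12 : p <= 1 / 2).

(** The block [Ds] makes the function nearly flat up to an error [e]; over [Ms] the moment bound for
    [e^2] and Jensen's inequality bound the average of [e]. *)
Lemma prob_round (N r s : nat) (beta b a sigma lam : R) (g : int -> R)
    (Ds Ms : seq (seq int)) :
  (0 < N)%N -> (0 < r)%N -> (0 < s)%N -> 1 <= a -> a ^+ r`! <= 2 -> 0 < b ->
  0 < sigma <= 1 -> 2 < r.+1%:R * sigma ^+ 2 -> 0 < lam ->
  size Ds = (2 * s)%N -> size Ms = (2 * s)%N ->
  (forall B, B \in Ds -> thick N B) -> (forall B, B \in Ms -> thick N B) ->
  regular N beta b a g -> mass_le g 1 ->
  let D := 4 * (r`!)%:R ^+ 2 / (p * (1 - p)) * b / s%:R in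
  prob_le (Ds ++ Ms) (fun x => exists t, 4 * beta / N%:R + lam < avg p g x t)
   ((4 * sigma) ^+ s +
    D / lam ^+ 2 * ((D / (2 * N)%:R + b ^+ 2 * (1 - p) ^+ s) / lam ^+ 2) ^+ s).
Proof.
have [h0 h1] := (p_gt0, p_le12).
have [p0 p1 p1'] : [/\ 0 <= p, p <= 1 & p < 1] by split; lra.
move=> N0 r0 s0 a1 aq b0 /andP[sg0 sg1] rs lam0 sD sM tD tM regg g1 D.
have P0 : 0 < p * (1 - p) by rewrite mulr_gt0 // subr_gt0.
have s0' : 0 < s%:R :> R by rewrite ltr0n.
have N0' : 0 < N%:R :> R by rewrite ltr0n.
have l20 : 0 < lam ^+ 2 by rewrite exprn_gt0.
(* Chosen so that the initial energy, at most [b], equals [s] decrements. *)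
pose c := b / (s%:R * (p * (1 - p))).
have c0 : 0 < c by rewrite divr_gt0 // mulr_gt0.
have DE : 4 * (r`!)%:R ^+ 2 * c = D.
  by rewrite /D /c; field; rewrite ?gt_eqF //=; lra.
have D0 : 0 <= D.
  by rewrite -DE mulr_ge0 ?(ltW c0) // mulr_ge0 ?ler0n // exprn_ge0 ?ler0n.
have eg : mass_le (fun t => g t ^+ 2) (s%:R * (p * (1 - p) * c)).
  have -> : s%:R * (p * (1 - p) * c) = b * 1.
    by rewrite /c; field; rewrite ?gt_eqF //=; lra.
  by apply: mass_le_sqr => //; case: regg.
have sg01 : 0 < sigma <= 1 by rewrite sg0.
have pD := prob_not_nearly_flat p_gt0 p1' N0 r0 a1 aq c0 sg01 rs tD regg eg.
rewrite DE sD in pD.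
apply: (prob_le_cat _ (prob_leW _ pD)).
- apply: mulr_ge0; first exact: divr_ge0 D0 (ltW l20).
  apply/exprn_ge0/divr_ge0; last exact: ltW.
  apply: addr_ge0; first exact: divr_ge0 D0 (ler0n _ _).
  by rewrite mulr_ge0 ?sqr_ge0 // exprn_ge0 // subr_ge0.
(* Of the [2 s] factors [sigma], half pay for the decrements; [((1 + sigma)^2 * sigma)^s] is
   left. *)
- rewrite exprM -expr_div_n; apply: lerXn2r.
  + by rewrite nnegrE divr_ge0 ?(ltW sg0) // sqr_ge0.
  + by rewrite nnegrE mulr_ge0 ?(ltW sg0).
  have -> : ((1 + sigma) * sigma) ^+ 2 / sigma = (1 + sigma) ^+ 2 * sigma.
    by field; rewrite gt_eqF.
  rewrite ler_wpM2r ?(ltW sg0) //.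
  have -> : (1 + sigma) ^+ 2 = 4 - (1 - sigma) * (3 + sigma) by ring.
  by rewrite gerBl mulr_ge0 ?subr_ge0 // addr_ge0 // ltW.
- move=> x xD /contrapT[e [eb eD ge]].
  have e0 t : 0 <= e t by have /andP[] := eb t.
  have tail := @moment_tail _ p (2 * s)%N Ms (2 * N)%N
    (fun t => e t ^+ 2) D (b ^+ 2) (lam ^+ 2) s.
  have sE : (2 * s - s)%N = s by rewrite mul2n -addnn addnK.
  rewrite sE in tail.
  apply: prob_le_mono (tail p0 p_le12 sM _ _ _ _ _ eD l20 _).
  + move=> y _ [t]; rewrite avg_cat => lt; exists t.
    apply: lt_le_trans (avg_sqr_le p0 p1 e y t).
    rewrite ltr_sqr ?nnegrE ?(ltW lam0) ?avg_ge0 //.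
    have := avg_mono p0 p1 y ge t; rewrite avgD // avg_cst // => le.
    by move: (lt_le_trans lt le); rewrite ltrD2l.
  + by apply/allP => B /tM[].
  + by rewrite muln_gt0.
  + by move=> B /tM[].
  + by move=> u; apply: sqr_ge0.
  + by move=> u; rewrite lerXn2r ?nnegrE ?(ltW b0) //; have /andP[] := eb u.
  + by rewrite leq_pmull.
Qed.

End Round.

(** * Numerical estimates for the tail bounds *)

Section Numerics.
Variable R : realFieldType.
Implicit Types (G Gam x y z : R).

(** The prefactor may be as large as [N <= G ^+ s]; the extra factor [G] in the base absorbs it. *)
Lemma tail_num G Gam x y (s : nat) : 1 <= G -> 1 <= Gam ->
  0 <= x <= G ^+ s -> 0 <= y <= (5 * Gam * G)^-1 ->
  x * y ^+ s <= (5 * Gam)^-1 ^+ s.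
Proof.
move=> G1 Gam1 /andP[x0 xG] /andP[y0 yG].
have G0 : 0 < G by lra.
have Gam0 : 0 < Gam by lra.
apply: (@le_trans _ _ (G ^+ s * (5 * Gam * G)^-1 ^+ s)).
  by apply: ler_pM; rewrite ?exprn_ge0 //; apply: lerXn2r; rewrite ?nnegrE ?(le_trans y0 yG).
rewrite -exprMn le_eqVlt; apply/orP; left; apply/eqP; congr (_ ^+ _).
by field; rewrite !gt_eqF.
Qed.

(** Adds up five failure events: one for the first moment bound and two for each round. *)
Lemma total_num Gam (s : nat) : 1 <= Gam -> (0 < s)%N ->
  5 * (5 * Gam)^-1 ^+ s <= Gam^-1 ^+ s.
Proof.
move=> Gam1; case: s => // s _; have Gam0 : 0 < Gam by lra.
rewrite invfM exprMn mulrA; rewrite -[leRHS]mul1r ler_wpM2r ?exprn_ge0 ?invr_ge0 ?(ltW Gam0) //.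
rewrite exprS mulrA mulfV ?mul1r; last by rewrite gt_eqF //; lra.
by apply: exprn_ile1; lra.
Qed.

Lemma stageA_num G Gam R1 N c (s : nat) : 1 <= G -> 1 <= Gam -> R1 = 10 * G * Gam ->
  0 < N -> N <= G ^+ s -> 0 <= c <= N^-1 ->
  1 / (R1 / N) * ((1 / (2 * N) + 1 * c) / (R1 / N)) ^+ s <= (5 * Gam)^-1 ^+ s.
Proof.
move=> G1 Gam1 R1E N0 NG /andP[c0 cN].
have G0 : 0 < G by lra.
have Gam0 : 0 < Gam by lra.
have R11 : 1 <= R1.
  rewrite R1E -[1]mulr1; apply: ler_pM => //; lra.
have R10 : 0 < R1 by lra.
apply: (@tail_num G) => //; apply/andP; split.
- by rewrite divr_ge0 // divr_ge0 // ltW.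
- have -> : 1 / (R1 / N) = N / R1 by field; rewrite !gt_eqF.
  by rewrite ler_pdivrMr //; apply: le_trans NG _; rewrite ler_peMr // exprn_ge0 // ltW.
- rewrite divr_ge0 ?divr_ge0 ?(ltW R10) ?(ltW N0) // addr_ge0 ?mul1r //.
  by rewrite invr_ge0 mulr_ge0 // ltW.
- have -> : (1 / (2 * N) + 1 * c) / (R1 / N) = (2^-1 + N * c) / R1.
    by field; rewrite !gt_eqF.
  have Nc : N * c <= 1 by rewrite mulrC -ler_pdivlMr // div1r.
  have -> : (5 * Gam * G)^-1 = 2 / R1 by rewrite R1E; field; rewrite !gt_eqF.
  by rewrite ler_wpM2r ?invr_ge0 ?(ltW R10) //; lra.
Qed.

(** First round, from [R1 / N] to order [1 / (N * w)] with [w = sqrt s]; the constant [R2] pays for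
    [Gam], hence depends on [M]. *)
Lemma round1_num G Gam p C R1 R2 N w S c (s : nat) : 1 <= G -> 1 <= Gam -> 0 < p ->
  0 <= C -> 0 <= R1 -> 1 + 5 * Gam * G * (C * R1 + R1 ^+ 2 / p) <= R2 ->
  0 < N -> N <= G ^+ s -> 0 < w -> w ^+ 2 = S -> 0 <= c -> p * S * c <= 1 ->
  forall D lam, D = C * (R1 / N) / S -> lam = R2 / (N * w) ->
  D / lam ^+ 2 * ((D / (2 * N) + (R1 / N) ^+ 2 * c) / lam ^+ 2) ^+ s
    <= (5 * Gam)^-1 ^+ s.
Proof.
move=> G1 Gam1 p0 C0 R10 R2b N0 NG w0 wS c0 Sc D lam DE lamE.
have G0 : 0 < G by lra.
have Gam0 : 0 < Gam by lra.
have GG : 1 <= 5 * Gam * G.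
  rewrite -[1]mulr1; apply: ler_pM => //; lra.
have GG0 : 0 < 5 * Gam * G by lra.
have [Z ZE] : exists Z, Z = C * R1 + R1 ^+ 2 / p by eexists.
rewrite -ZE in R2b.
have R1p : 0 <= R1 ^+ 2 / p by rewrite divr_ge0 ?sqr_ge0 // ltW.
have CR1 : 0 <= C * R1 by apply: mulr_ge0.
have Z0 : 0 <= Z by rewrite ZE addr_ge0.
have GZ0 : 0 <= 5 * Gam * G * Z by rewrite mulr_ge0 // ltW.
have GZ : Z <= 5 * Gam * G * Z by rewrite ler_peMl.
have R21 : 1 <= R2 by lra.
have R20 : 0 < R2 by lra.
have R2sq : R2 <= R2 ^+ 2 by rewrite expr2 ler_peMl // ltW.
have R2sq0 : 0 < R2 ^+ 2 by lra.
have E1 : D / lam ^+ 2 = N * (C * R1 / R2 ^+ 2).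
  by rewrite DE lamE -wS; field; rewrite !gt_eqF.
have E2 : (D / (2 * N) + (R1 / N) ^+ 2 * c) / lam ^+ 2 =
   (C * R1 / 2 + R1 ^+ 2 * (S * c)) / R2 ^+ 2.
  by rewrite DE lamE -wS; field; rewrite !gt_eqF.
have S0 : 0 <= S by rewrite -wS sqr_ge0.
have Scp : S * c <= p^-1 by rewrite -[leRHS]div1r ler_pdivlMr //; lra.
have Sc0 : 0 <= S * c by apply: mulr_ge0.
have RSc : R1 ^+ 2 * (S * c) <= R1 ^+ 2 / p by rewrite ler_wpM2l ?sqr_ge0.
have RSc0 : 0 <= R1 ^+ 2 * (S * c) by rewrite mulr_ge0 ?sqr_ge0.
rewrite E1 E2; apply: (@tail_num G) => //; apply/andP; split.
- by rewrite mulr_ge0 ?divr_ge0 // ltW.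
- apply: le_trans NG; rewrite -[leRHS]mulr1 ler_wpM2l ?(ltW N0) //.
  by rewrite ler_pdivrMr // mul1r; lra.
- by rewrite divr_ge0 ?(ltW R2sq0) // addr_ge0 // divr_ge0.
- rewrite ler_pdivrMr // [leRHS]mulrC ler_pdivlMr //.
  apply: (@le_trans _ _ (5 * Gam * G * Z)); last by lra.
  by rewrite [leLHS]mulrC ler_wpM2l ?(ltW GG0) //; lra.
Qed.

(** Second round: the supremum already carries the factor [1 / w], so a large [S] pays for [Gam] and
    [lam] needs no constant depending on it. *)
Lemma round2_num G Gam p C B N w S c (s : nat) : 1 <= G -> 1 <= Gam -> 0 < p ->
  0 <= C -> 0 <= B -> 10 * Gam * G * (C * B) <= w -> 10 * Gam * G * B ^+ 2 <= p * S ->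
  0 < N -> N <= G ^+ s -> 0 < w -> w ^+ 2 = S -> 0 <= c -> p * S * c <= 1 ->
  forall D lam, D = C * (B / (N * w)) / S -> lam = 1 / (N * w) ->
  D / lam ^+ 2 * ((D / (2 * N) + (B / (N * w)) ^+ 2 * c) / lam ^+ 2) ^+ s
    <= (5 * Gam)^-1 ^+ s.
Proof.
move=> G1 Gam1 p0 C0 B0 H1 H2 N0 NG w0 wS c0 Sc D lam DE lamE.
have G0 : 0 < G by lra.
have Gam0 : 0 < Gam by lra.
have GG : 1 <= 10 * Gam * G.
  rewrite -[1]mulr1; apply: ler_pM => //; lra.
have GG0 : 0 < 10 * Gam * G by lra.
have CB0 : 0 <= C * B by apply: mulr_ge0.
have S0 : 0 < S by rewrite -wS exprn_gt0.
have E1 : D / lam ^+ 2 = N * (C * B / w).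
  by rewrite DE lamE -wS; field; rewrite !gt_eqF.
have E2 : (D / (2 * N) + (B / (N * w)) ^+ 2 * c) / lam ^+ 2 =
   C * B / w / 2 + B ^+ 2 * c.
  by rewrite DE lamE -wS; field; rewrite !gt_eqF.
have h1 : C * B / w <= (10 * Gam * G)^-1.
  by rewrite ler_pdivrMr // [leRHS]mulrC ler_pdivlMr // [leLHS]mulrC.
have h2 : B ^+ 2 * c <= (10 * Gam * G)^-1.
  rewrite -[leRHS]div1r ler_pdivlMr //; apply: le_trans Sc.
  by rewrite mulrAC ler_wpM2r // mulrC.
have Bc0 : 0 <= B ^+ 2 * c by rewrite mulr_ge0 ?sqr_ge0.
have CBw : 0 <= C * B / w by rewrite divr_ge0 // ltW.
rewrite E1 E2; apply: (@tail_num G) => //; apply/andP; split.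
- by rewrite mulr_ge0 // ltW.
- apply: le_trans NG; rewrite -[leRHS]mulr1 ler_wpM2l ?(ltW N0) //.
  apply: le_trans h1 _; rewrite invf_le1 //.
- by rewrite addr_ge0 // divr_ge0.
- have -> : (5 * Gam * G)^-1 = 2 * (10 * Gam * G)^-1 by field; rewrite !gt_eqF.
  lra.
Qed.

End Numerics.

(** * Combination of the blocks *)

Section Core.
Variables (R : rcfType) (p : R).
Hypotheses (p_gt0 : 0 < p) (p_le12 : p <= 1 / 2).

(* E1 and E2 serve the Littlewood-Offord bound, As the first moment bound, and
   (Di, Mi) is the decrement block and the moment block of the i-th round. *)
Lemma prob_avg_gt (G Gam a sigma R2 : R) (N r s : nat) (f : int -> R)
    (E1 E2 As D1 M1 D2 M2 : seq (seq int)) :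
  let R1 := 10 * G * Gam in
  let C := 4 * (r`!)%:R ^+ 2 / (p * (1 - p)) in
  let B := 8 * lo_const p + R2 in
  (0 < N)%N -> (0 < s)%N -> (0 < r)%N -> 1 <= a -> a ^+ r`! <= 2 ->
  1 <= G -> 1 <= Gam -> N%:R <= G ^+ s ->
  sigma = (20 * Gam)^-1 -> 2 < r.+1%:R * sigma ^+ 2 ->
  1 + 5 * Gam * G * (C * R1 + R1 ^+ 2 / p) <= R2 ->
  10 * Gam * G * (C * B) <= Num.sqrt s%:R ->
  10 * Gam * G * B ^+ 2 <= p * s%:R ->
  (1 - p) ^+ (size As - s) <= N%:R^-1 -> (s <= size As)%N ->
  size E1 = s -> size E2 = s -> size D1 = (2 * s)%N -> size M1 = (2 * s)%N ->
  size D2 = (2 * s)%N -> size M2 = (2 * s)%N ->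
  (forall A, A \in E1 ++ E2 ++ As ++ D1 ++ M1 ++ D2 ++ M2 -> thick N A) ->
  (forall A, A \in E1 ++ E2 -> {in A, forall x, (N <= `|x|)%N}) ->
  (forall t, 0 <= f t) -> mass_le f 1 -> (forall t, f t <= a * f (t + 1)) ->
  prob_le ((E1 ++ E2) ++ As ++ (D1 ++ M1) ++ (D2 ++ M2))
    (fun x => exists t,
       (8 * lo_const p + 1) / (N%:R * Num.sqrt s%:R) < avg p f x t)
    (Gam^-1 ^+ s).
Proof.
have [h0 h1] := (p_gt0, p_le12).
have [p0 p1] : 0 <= p /\ p <= 1 by split; lra.
move=> R1 C B N0 s0 r0 a1 aq G1 Gam1 NG sgE rs R2b H1 H2 cN sA.
move=> sE1 sE2 sD1 sM1 sD2 sM2 tk far f0 f1 fa.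
have N0' : 0 < N%:R :> R by rewrite ltr0n.
have s0' : 0 < s%:R :> R by rewrite ltr0n.
set w := Num.sqrt s%:R in H1 *.
have w0 : 0 < w by rewrite sqrtr_gt0.
have wS : w ^+ 2 = s%:R by rewrite sqr_sqrtr ?ler0n.
have Gam0 : 0 < Gam by lra.
have G0 : 0 < G by lra.
have q0 : 0 < 1 - p by lra.
have P0 : 0 < p * (1 - p) by rewrite mulr_gt0.
have C0 : 0 <= C.
  by rewrite divr_ge0 ?(ltW P0) // mulr_ge0 ?exprn_ge0 ?ler0n.
have lo0 : 0 < lo_const p by rewrite divr_gt0 ?sqrtr_gt0.
have R10 : 0 < R1 by rewrite mulr_gt0 ?mulr_gt0.
have R21 : 1 <= R2.
  apply: le_trans R2b; rewrite lerDl; apply: mulr_ge0.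
    by rewrite mulr_ge0 ?(ltW G0) // mulr_ge0 // ltW.
  apply: addr_ge0; first exact: mulr_ge0 C0 (ltW R10).
  by rewrite divr_ge0 ?sqr_ge0.
have B0 : 0 < B by apply: addr_gt0; [rewrite mulr_gt0 ?ltr0n|exact: lt_le_trans ltr01 R21].
have c0 : 0 <= (1 - p) ^+ s by rewrite exprn_ge0 // ltW.
have Sc : p * s%:R * (1 - p) ^+ s <= 1 by apply: mulrn_exp1p_le; rewrite p0.
have sg0 : 0 < sigma by rewrite sgE invr_gt0 mulr_gt0.
have sg01 : 0 < sigma <= 1.
  by rewrite sg0 sgE invf_le1 ?mulr_gt0 //; lra.
have sg5 : 4 * sigma = (5 * Gam)^-1 by rewrite sgE; field; rewrite gt_eqF.
set y := (5 * Gam)^-1 ^+ s.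
have y0 : 0 <= y by rewrite exprn_ge0 // invr_ge0 mulr_ge0 // ltW.
pose beta := 2 * lo_const p / w.
have betaE : 4 * beta / N%:R = 8 * lo_const p / (N%:R * w).
  by rewrite /beta; field; rewrite !gt_eqF.
have tkA A : A \in As -> thick N A by move=> h; apply: tk; rewrite !mem_cat h !orbT.
have tkD1 A : A \in D1 -> thick N A by move=> h; apply: tk; rewrite !mem_cat h !orbT.
have tkM1 A : A \in M1 -> thick N A by move=> h; apply: tk; rewrite !mem_cat h !orbT.
have tkD2 A : A \in D2 -> thick N A by move=> h; apply: tk; rewrite !mem_cat h !orbT.
have tkM2 A : A \in M2 -> thick N A by move=> h; apply: tk; rewrite !mem_cat h !orbT.
(* The Littlewood-Offord block never fails, the first moment block costs [y], and each round costs
   [y + y]. *)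
apply: (@prob_leW _ _ _ (0 + (y + ((y + y) + (y + y))))).
  apply: le_trans (total_num Gam1 s0); rewrite -/y; lra.
have yy0 : 0 <= y + y by rewrite addr_ge0.
apply: (@prob_le_cat _ _ _ _ (fun=> False)).
- by rewrite addr_ge0 // addr_ge0.
- by apply: prob_le_false => // x _ [].
move=> xs xsE _.
pose f1' := avg p f xs.
have f1'0 t : 0 <= f1' t by apply: avg_ge0.
have f1'm : mass_le f1' 1 by apply: mass_le_avg.
have f1'1 t : f1' t <= 1 by apply: mass_le_pt.
have f1'a t : f1' t <= a * f1' (t + 1).
  by rewrite /f1' -avg_shift -avgZ; apply: avg_mono.
have f1'beta t : imass N f1' t <= beta.
  have sxs : size xs = (s + s)%N by rewrite (size_word xsE) size_cat sE1 sE2.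
  have xsfar : {in xs, forall x, (N <= `|x|)%N}.
    move=> x /(nthP 0)[i lti <-]; have lti' := lti; rewrite (size_word xsE) in lti'.
    apply: far (nth_word 0 xsE lti'); exact: mem_nth.
  have ss : s = minn s (size xs) by rewrite sxs (minn_idPl (leq_addr _ _)).
  have := @littlewood_offord _ p N p_gt0 p_le12 N0 f (take s xs) (drop s xs) s f0 f1.
  rewrite size_take_min size_drop sxs addnK (minn_idPl (leq_addr _ _)).
  rewrite cat_take_drop => /(_ erefl erefl _ _ t) lo.
  apply: le_trans (lo _ _) _.
  - by move=> x /mem_take; apply: xsfar.
  - by move=> x /mem_drop; apply: xsfar.
  rewrite /beta; apply: ler_wpM2l; first by rewrite mulr_ge0 ?ler0n // ltW.
  by rewrite lef_pV2 ?posrE ?sqrtr_gt0 ?ltr0n // ler_wsqrtr // ler_nat.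
pose lam1 := R2 / (N%:R * w).
apply: (@prob_le_cat _ _ _ _ (fun u => exists t, R1 / N%:R < avg p f1' u t)).
- by rewrite addr_ge0.
- have tail := @moment_tail _ p (size As) As (2 * N)%N f1' 1 1 (R1 / N%:R) s.
  apply: (prob_leW _ (tail p0 p_le12 _ _ _ _ f1'0 f1'1 f1'm _ sA)) => //.
  + by rewrite natrM; apply: (stageA_num (G := G)) => //; rewrite exprn_ge0 // ltW.
  + by apply/allP => A /tkA[].
  + by rewrite muln_gt0.
  + by move=> A /tkA[].
  + by rewrite divr_gt0.
move=> us _ /forallNP usR1.
pose f2 := avg p f1' us.
have f2reg : regular N beta (R1 / N%:R) a f2.
  split => t; first by rewrite avg_ge0 //= leNgt; apply/negP; apply: usR1.
    by rewrite /f2 imass_avg; apply: avg_le.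
  by rewrite /f2 -avg_shift -avgZ; apply: avg_mono.
have f2m : mass_le f2 1 by apply: mass_le_avg.
apply: (@prob_le_cat _ _ _ _ (fun u => exists t, 4 * beta / N%:R + lam1 < avg p f2 u t)).
- by rewrite addr_ge0.
- have := prob_round p_gt0 p_le12 N0 r0 s0 a1 aq _ sg01 rs _ sD1 sM1 tkD1 tkM1 f2reg f2m.
  move=> /(_ lam1) rd; apply: prob_leW (rd _ _).
  + rewrite sg5 -/y lerD2l natrM.
    by apply: (round1_num (G := G) (p := p) (C := C) (R2 := R2) (w := w)
      (S := s%:R)) => //; rewrite ltW.
  + by rewrite divr_gt0.
  + by rewrite divr_gt0 ?mulr_gt0 //; lra.
move=> vs _ /forallNP vsR2.
pose f3 := avg p f2 vs.
have Bw : 4 * beta / N%:R + lam1 = B / (N%:R * w) by rewrite betaE /lam1 /B -mulrDl.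
have f3reg : regular N beta (B / (N%:R * w)) a f3.
  case: f2reg => f2b f2beta f2a.
  split => t.
  - rewrite avg_ge0 //=; last by move=> u; have /andP[] := f2b u.
    by rewrite leNgt -Bw; apply/negP; apply: vsR2.
  - by rewrite /f3 imass_avg; apply: avg_le.
  - by rewrite /f3 -avg_shift -avgZ; apply: avg_mono.
have f3m : mass_le f3 1 by apply: mass_le_avg.
have := prob_round p_gt0 p_le12 N0 r0 s0 a1 aq _ sg01 rs _ sD2 sM2 tkD2 tkM2 f3reg f3m.
move=> /(_ (1 / (N%:R * w))) rd.
have {}rd : prob_le (D2 ++ M2) (fun x => exists t,
    4 * beta / N%:R + 1 / (N%:R * w) < avg p f3 x t) (y + y).
  apply: prob_leW (rd _ _).
  + rewrite sg5 -/y lerD2l natrM.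
    by apply: (round2_num (G := G) (p := p) (C := C) (B := B) (w := w)
      (S := s%:R)) => //; rewrite ltW.
  + by rewrite divr_gt0 ?mulr_gt0.
  + by rewrite divr_gt0 ?mulr_gt0.
apply: prob_le_mono rd => x _ [t]; rewrite !avg_cat -/f1' -/f2 -/f3 => lt; exists t.
by rewrite betaE -mulrDl.
Qed.

End Core.

(** * The random function and its probability space *)

Section Model.
Variable R : realType.

Lemma bern_codom (p : R) n (v : {ffun 'I_n -> bool}) :
  bern p [seq v j | j <- enum 'I_n] =
  p ^+ (\sum_(j < n) (v j : nat))%N * (1 - p) ^+ (n - \sum_(j < n) (v j : nat))%N.
Proof.
have -> : (n - \sum_(j < n) (v j : nat) = \sum_(j < n) (~~ v j : nat))%N.
  rewrite -{1}[n]card_ord -sum1_card -sumnB => [|j _]; last by case: (v j).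
  by apply: eq_bigr => j _; case: (v j).
rewrite /bern big_map big_enum -!prodrXr -big_split /=.
by apply: eq_bigr => j _; case: (v j); rewrite ?expr0 ?expr1 ?mulr1 ?mul1r.
Qed.

Lemma frand_avg (f : int -> R) (p : R) n (x : nat -> int) t :
  frand f p n x t = avg p f (mkseq x n) t.
Proof.
pose phi (v : {ffun 'I_n -> bool}) := [seq v j | j <- enum 'I_n].
have sphi v : size (phi v) = n by rewrite size_map size_enum_ord.
have nphi v (j : 'I_n) : nth false (phi v) j = v j.
  by rewrite (nth_map j) ?size_enum_ord // nth_ord_enum.
have pe : perm_eq (map phi (index_enum {ffun 'I_n -> bool})) (bits n).
  apply: uniq_perm.
  - rewrite map_inj_uniq ?index_enum_uniq // => v w vw; apply/ffunP => j.
    by rewrite -!nphi vw.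
  - exact: uniq_bits.
  - move=> u; apply/mapP/idP => [[v _ ->]|ub]; first by rewrite -(sphi v) mem_bits.
    exists [ffun j : 'I_n => nth false u j]; first by rewrite mem_index_enum.
    apply: (@eq_from_nth _ false) => [|i]; rewrite (size_bits ub) ?sphi // => lti.
    by rewrite (nphi _ (Ordinal lti)) ffunE.
rewrite avg_bern size_mkseq -(perm_big _ pe) big_map /frand.
apply: eq_bigr => v _; rewrite -bern_codom; congr (_ * f (_ + _)).
rewrite (dotE (sphi v) (size_mkseq x n)); apply: eq_bigr => j _.
by rewrite nphi nth_mkseq.
Qed.

Definition supports n (A : 'I_n -> {fset int}) : seq (seq int) :=
  [seq enum_fset (A i) | i <- enum 'I_n].

Lemma size_supports n (A : 'I_n -> {fset int}) : size (supports A) = n.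
Proof. by rewrite size_map size_enum_ord. Qed.

Lemma nth_supports n (A : 'I_n -> {fset int}) (i : 'I_n) :
  nth [::] (supports A) i = enum_fset (A i).
Proof. by rewrite (nth_map i) ?size_enum_ord // nth_ord_enum. Qed.

Lemma prob_supports n (A : 'I_n -> {fset int}) (E : (nat -> int) -> Prop)
    (P : seq int -> Prop) (c : R) :
  0 <= c -> (forall x, E x -> P (mkseq x n)) -> prob_le (supports A) P c ->
  prob A E <= c.
Proof.
move=> c0 EP Pc.
pose phi (w : sample A) := mkseq (realise w) n.
have nphi w (i : 'I_n) : nth 0 (phi w) i = val (w i).
  by rewrite nth_mkseq // /realise valK.
have pe : perm_eq (map phi (index_enum (sample A))) (words (supports A)).
  apply: uniq_perm.
  - rewrite map_inj_uniq ?index_enum_uniq // => v w vw; apply/ffunP => i.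
    by apply: val_inj; rewrite -!nphi vw.
  - by apply: uniq_words; apply/allP => _ /mapP[i _ ->]; apply: fset_uniq.
  - move=> u; apply/mapP/idP => [[w _ ->]|uw].
      apply: (mem_wordsP (x0 := 0)) => [|i]; rewrite size_supports ?size_mkseq //.
      move=> lti; rewrite (nth_supports A (Ordinal lti)) (nphi w (Ordinal lti)).
      exact: valP.
    have uA (i : 'I_n) : nth 0 u i \in A i.
      by have := nth_word 0 uw; rewrite size_supports => /(_ i (ltn_ord i)); rewrite nth_supports.
    exists [ffun i => FSetSub (uA i)]; first by rewrite mem_index_enum.
    apply: (@eq_from_nth _ 0) => [|i]; rewrite (size_word uw) size_supports ?size_mkseq //.
    by move=> lti; rewrite (nphi _ (Ordinal lti)) ffunE.
have szE : size (words (supports A)) = #|{: sample A}|.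
  by rewrite -(perm_size pe) size_map cardT enumT.
(* With an empty support the quotient has denominator 0 and equals 0. *)
rewrite /prob; have [->|card0] := posnP #|{: sample A}|.
  by rewrite invr0 mulr0.
rewrite ler_pdivrMr ?ltr0n // -szE; apply: le_trans Pc.
rewrite -(perm_big _ pe) big_map -sum1_card natr_sum big_mkcond /=.
apply: ler_sum => w _; rewrite inE; case: asboolP => [/EP Ew|_].
  by rewrite asboolT.
exact: ler0n.
Qed.

(** The larger set is [A] with the [N] integers after each of the two right ends; these number
    [2 N], at most the size of [A]. *)
Lemma thick_union N (A S1 S2 : {fset int}) : int_interval S1 -> int_interval S2 ->
  A = (S1 `|` S2)%fset -> (2 * N <= #|` A|)%N -> thick N (enum_fset A).
Proof.
move=> [c1 [d1 S1E]] [c2 [d2 S2E]] AE NA.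
split => //; first exact: fset_uniq.
pose ext (d : int) := [seq d + k.+1%:Z | k <- iota 0 N].
have mem_ext d u : d < u <= d + N%:Z -> u \in ext d.
  move=> /andP[du uN]; apply/mapP; exists (absz (u - d - 1)%R); last by lia.
  by rewrite mem_iota; lia.
exists (enum_fset A ++ ext d1 ++ ext d2) => [|x j xA jN].
  rewrite !size_cat !size_map size_iota.
  by move: NA; set k := size (enum_fset A); rewrite -/k; lia.
rewrite !mem_cat; have : (x \in S1) || (x \in S2) by rewrite -in_fsetU -AE.
have memA u : (u \in S1) || (u \in S2) -> u \in enum_fset A.
  by rewrite -in_fsetU -AE.
case/orP; rewrite ?S1E ?S2E => /andP[lo hi].
- have [le|gt] := leP (x + j%:Z) d1.
    by rewrite memA // S1E le andbT; apply/orP; left; lia.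
  by rewrite [_ \in ext d1]mem_ext ?orbT //; lia.
- have [le|gt] := leP (x + j%:Z) d2.
    by rewrite memA // S2E le andbT; apply/orP; right; lia.
  by rewrite [_ \in ext d2]mem_ext ?orbT //; lia.
Qed.

Lemma thick_admissible N n (K delta : R) (A : 'I_n -> {fset int}) i :
  admissible N K delta A -> thick N (enum_fset (A i)).
Proof.
move=> [_ big small _ _].
have [lt|le] := ltP (delta * n%:R) i.+1%:R.
  have [iA sA] := big i lt.
  (* A single interval is the union of two copies of itself. *)
  by apply: (thick_union iA iA); rewrite ?fsetUid //; lia.
have [[S1 [S2 [i1 [i2 AE]]]] sA _] := small i le.
exact: thick_union i1 i2 AE sA.
Qed.

Lemma far_admissible N n (K delta : R) (A : 'I_n -> {fset int}) (i : 'I_n) x :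
  admissible N K delta A -> i.+1%:R <= delta * n%:R -> x \in A i -> (N <= `|x|)%N.
Proof.
move=> [_ _ small _ _] le xA; have [_ _ /(_ x xA)] := small i le.
by move=> h; rewrite leqNgt; apply/negP => lt; apply: h; lia.
Qed.

Lemma mass_le_esum (f : int -> R) : (forall t, 0 <= f t) -> l1_norm_one f -> mass_le f 1.
Proof.
move=> f0 f1 s us; rewrite -lee_fin -f1.
rewrite -sumEFin; apply: esum_ge; exists [set` s]%classic.
  by split => //; apply: finite_seq.
by rewrite -fsbig_seq.
Qed.

Lemma log2_lipschitz_le (f : int -> R) (eta : R) : log2_lipschitz f eta ->
  forall t, f t <= expR (eta * ln 2) * f (t + 1).
Proof.
move=> [f0 lip] t; have ln2 : 0 < ln 2 :> R by rewrite ln_gt0 // ltr1n.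
have := lip t; rewrite /log2 -mulrBl normrM (gtr0_norm (x := (ln 2)^-1)) ?invr_gt0 //.
rewrite ler_pdivrMr // => /(le_trans (ler_norm _)).
rewrite -{2}[f t](lnK (f0 t)) -{2}[f (t + 1)](lnK (f0 (t + 1))).
by rewrite -expRD ler_expR; lra.
Qed.

End Model.

(** * Choice of the constants and conclusion *)

Lemma exists_nat_ge (R : realType) (x : R) : exists m : nat, (0 < m)%N /\ x <= m%:R.
Proof.
exists (Num.bound `|x|); split; first by rewrite /Num.bound.
exact: le_trans (ler_norm x) (ltW (archi_boundP (normr_ge0 x))).
Qed.

Lemma expn_small (R : realType) (x c : R) : 0 <= x < 1 -> 0 < c ->
  exists m : nat, forall k : nat, (m <= k)%N -> x ^+ k <= c.
Proof.
move=> /andP[x0 x1] c0; have [m [m0 mle]] := exists_nat_ge (1 / ((1 - x) * c)).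
exists m => k mk; have x1' : 0 < 1 - x by lra.
apply: (@le_trans _ _ (x ^+ m)); first by rewrite ler_wiXn2l // ltW.
have m0' : 0 < m%:R :> R by rewrite ltr0n.
have bern : (1 - x) * m%:R * x ^+ m <= 1.
  have -> : x = 1 - (1 - x) by ring.
  by rewrite {1}subKr; apply: mulrn_exp1p_le; lra.
rewrite -(ler_pM2l (x := (1 - x) * m%:R)) ?mulr_gt0 //; apply: le_trans bern _.
by move: mle; rewrite ler_pdivrMr ?mulr_gt0 // mulrCA mulrA.
Qed.

Lemma split_size (T : Type) (W : seq T) a b : size W = (a + b)%N ->
  exists U V, [/\ W = U ++ V, size U = a & size V = b].
Proof.
move=> sW; exists (take a W), (drop a W).
by rewrite cat_take_drop size_drop size_takel sW ?addKn ?leq_addr.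
Qed.

Lemma split_blocks (T : Type) (W : seq T) (s k : nat) :
  size W = (s + s + (k + (2 * s + 2 * s + (2 * s + 2 * s))))%N ->
  exists E1 E2 As D1 M1 D2 M2,
    W = (E1 ++ E2) ++ As ++ (D1 ++ M1) ++ (D2 ++ M2) /\
    [/\ size E1 = s, size E2 = s & size As = k] /\
    [/\ size D1 = (2 * s)%N, size M1 = (2 * s)%N,
        size D2 = (2 * s)%N & size M2 = (2 * s)%N].
Proof.
move=> /split_size[E [X [-> /split_size[E1 [E2 [-> e1 e2]]]]]].
move=> /split_size[As [Y [-> a]]].
move=> /split_size[X1 [X2 [-> /split_size[D1 [M1 [-> d1 m1]]]]]].
move=> /split_size[D2 [M2 [-> d2 m2]]].
by exists E1, E2, As, D1, M1, D2, M2.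
Qed.

Theorem theorem4p1 (R : realType) (delta p eps K : R) :
  0 < delta <= 1 -> 0 < p <= 1 / 2 -> 0 < eps < p -> 1 <= K ->
  exists L : R, 0 < L /\
  forall M : R, 1 <= M ->
  exists (n1 : nat) (eta : R), (1 <= n1)%N /\ 0 < eta <= 1 /\
  forall (n N : nat) (A : 'I_n -> {fset int}) (f : int -> R),
    (n1 <= n)%N -> (1 <= N)%N ->
    N%:R <= ((1 - p + eps) ^-1) ^+ n ->
    @admissible R N n K delta A ->
    (forall t, 0 <= f t) -> l1_norm_one f -> log2_lipschitz f eta ->
    @prob R n A (fun x => exists t : int,
              L / (N%:R * Num.sqrt n%:R) < frand f p n x t)
      <= expR (- (M * n%:R)).
Proof.
move=> /andP[d0 d1] /andP[p0 p12] /andP[e0 ep] K1.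
have q0 : 0 < 1 - p by lra.
have qe0 : 0 < 1 - p + eps by lra.
have x01 : 0 <= (1 - p) / (1 - p + eps) < 1.
  by rewrite divr_ge0 ?ltW //= ltr_pdivrMr // mul1r; lra.
(* The unit of block length will be [s = n %/ m0]. In [m0], [m1] makes the Odlyzko term at most
   [1 / N], [m2] puts the first [2 s] indices below [delta * n], and 11 leaves room for all
   blocks. *)
have [m1 m1P] := expn_small x01 (exprn_gt0 11 q0).
have [m2 [_ m2P]] := exists_nat_ge (2 / delta).
pose m0 := (m1 + m2 + 11)%N.
have m0_gt0 : (0 < m0)%N by rewrite addn_gt0 orbT.
have m00 : 0 < m0%:R :> R by rewrite ltr0n.
have xm0 : ((1 - p) / (1 - p + eps)) ^+ m0 <= (1 - p) ^+ 11.
  by apply: m1P; rewrite /m0 -addnA leq_addr.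
have dm0 : 2 <= delta * m0%:R.
  rewrite mulrC -ler_pdivrMr //; apply: le_trans m2P _.
  by rewrite ler_nat /m0 addnAC leq_addl.
have lo0 : 0 < lo_const p by rewrite divr_gt0 ?sqrtr_gt0 ?mulr_gt0.
(* Converts [sqrt s] into [sqrt n], as [n <= 2 * m0 * s]; it is chosen before [M]. *)
pose w0 : R := Num.sqrt (2 * m0%:R).
have w00 : 0 < w0 by rewrite sqrtr_gt0 mulr_gt0.
exists ((8 * lo_const p + 1) * w0); split.
  by rewrite mulr_gt0 // addr_gt0 // mulr_gt0.
move=> M M1.
have expR_ge1 x : 0 <= x -> 1 <= expR x :> R by move=> ?; rewrite -[leLHS](@expR0 R) ler_expR.
(* Makes [Gam^-1 ^+ s] at most [exp (- M n)]. *)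
pose Gam := expR (2 * M * m0%:R).
have Gam1 : 1 <= Gam by apply/expR_ge1/mulr_ge0; rewrite ?ler0n //; lra.
have Gam0 : 0 < Gam by lra.
(* As [1 - p + eps >= 1 / 2], this gives [N <= 2 ^ n <= G ^ s]. *)
pose G : R := 2 ^+ (2 * m0).
have G1 : 1 <= G by rewrite exprn_ege1 //; lra.
have G0 : 0 < G by lra.
pose sigma := (20 * Gam)^-1.
have sg0 : 0 < sigma by rewrite invr_gt0 mulr_gt0.
have [r [r0 rP]] := exists_nat_ge (2 / sigma ^+ 2).
have rs : 2 < r.+1%:R * sigma ^+ 2.
  rewrite -ltr_pdivrMr ?exprn_gt0 //; apply: le_lt_trans rP _.
  by rewrite ltr_nat.
pose C := 4 * (r`!)%:R ^+ 2 / (p * (1 - p)).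
pose R1 := 10 * G * Gam.
pose R2 := 1 + 5 * Gam * G * (C * R1 + R1 ^+ 2 / p).
pose B := 8 * lo_const p + R2.
pose H1 := 10 * Gam * G * (C * B).
(* [S1] and [S2] are the thresholds on [s] required by the second round. *)
have [S1 [S10 S1P]] := exists_nat_ge (H1 ^+ 2).
have [S2 [_ S2P]] := exists_nat_ge (10 * Gam * G * B ^+ 2 / p).
pose S0 := (S1 + S2)%N.
have fr0 : 0 < (r`!)%:R :> R by rewrite ltr0n fact_gt0.
(* With this [eta], [2 ^ eta] raised to the power [r!] is exactly 2. *)
exists (m0 * S0)%N, ((r`!)%:R^-1); split.
  by rewrite muln_gt0 m0_gt0 addn_gt0 S10.
split.
  by rewrite invr_gt0 fr0 /= invf_le1 // ler1n fact_gt0.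
move=> n N A f nn1 N0 NG adm f0 f1 flip.
pose s := (n %/ m0)%N.
have S0s : (S0 <= s)%N by rewrite /s leq_divRL // mulnC.
have s0 : (0 < s)%N by apply: leq_trans S0s; rewrite addn_gt0 S10.
have s0' : 0 < s%:R :> R by rewrite ltr0n.
have sn : (m0 * s <= n)%N by rewrite mulnC leq_divM.
have ns : (n <= 2 * m0 * s)%N.
  have := ltn_ceil n m0_gt0; rewrite -/s => lt; apply: leq_trans (ltnW lt) _.
  by rewrite mulnAC leq_mul2r mul2n -addnn -[s.+1]addn1 leq_add2l s0 orbT.
have s11 : (11 * s <= n)%N.
  by apply: leq_trans sn; rewrite leq_mul2r leq_addl orbT.
have N0' : 0 < N%:R :> R by rewrite ltr0n.
have n0' : 0 < n%:R :> R by rewrite ltr0n; apply: leq_trans s11; rewrite muln_gt0.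
have NGs : N%:R <= G ^+ s.
  apply: le_trans NG _; rewrite /G -exprM.
  apply: (@le_trans _ _ (2 ^+ n)); last by rewrite ler_weXn2l //; lra.
  apply: lerXn2r; rewrite ?nnegrE ?invr_ge0 ?(ltW qe0) //.
  by rewrite -[leRHS]invrK lef_pV2 ?posrE ?invr_gt0 //; lra.
have sqs : H1 <= Num.sqrt s%:R.
  apply: le_trans (ler_norm _) _; rewrite -sqrtr_sqr ler_wsqrtr //.
  by apply: le_trans S1P _; rewrite ler_nat; apply: leq_trans S0s; apply: leq_addr.
have ps : 10 * Gam * G * B ^+ 2 <= p * s%:R.
  rewrite [leRHS]mulrC -ler_pdivrMr //; apply: le_trans S2P _.
  by rewrite ler_nat; apply: leq_trans S0s; apply: leq_addl.
(* The other blocks take [10 s] indices, and a moment of order about [s] loses [s] more to the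
   rank. *)
have ce : (1 - p) ^+ (n - 10 * s - s) <= N%:R^-1.
  rewrite -[N%:R^-1]div1r ler_pdivlMr //.
  have -> : (n - 10 * s - s = n - 11 * s)%N by rewrite -subnDA -mulSnr.
  apply: (@le_trans _ _ ((1 - p) ^+ (n - 11 * s) * (1 - p + eps)^-1 ^+ n)).
    by rewrite ler_wpM2l // exprn_ge0 // ltW.
  have q11 : 0 < (1 - p) ^+ (11 * s) by rewrite exprn_gt0.
  rewrite -(ler_pM2l q11) mulr1 mulrA -exprD subnKC // -exprMn.
  have /andP[x0 x1] := x01.
  apply: (@le_trans _ _ (((1 - p) / (1 - p + eps)) ^+ (m0 * s))).
    by rewrite ler_wiXn2l // ltW.
  by rewrite !exprM; apply: lerXn2r; rewrite ?nnegrE ?exprn_ge0 // ltW.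
have sW : size (supports A) = (s + s + (n - 10 * s +
    (2 * s + 2 * s + (2 * s + 2 * s))))%N.
  by rewrite size_supports; move: s11; clear; lia.
have [E1 [E2 [As [D1 [M1' [D2 [M2 [WE [[e1 e2 sA] [sD1 sM1 sD2 sM2]]]]]]]]]] := split_blocks sW.
pose a := expR ((r`!)%:R^-1 * ln (2 : R)).
have ln20 : 0 <= ln 2 :> R by rewrite ln_ge0 // ler1n.
have a1 : 1 <= a by apply/expR_ge1/mulr_ge0; rewrite ?invr_ge0 ?ler0n.
have aq : a ^+ r`! <= 2.
  rewrite /a -expRM_natl mulrA mulfV ?gt_eqF // mul1r lnK // posrE; lra.
have tk B' : B' \in E1 ++ E2 ++ As ++ D1 ++ M1' ++ D2 ++ M2 -> thick N B'.
  have -> : E1 ++ E2 ++ As ++ D1 ++ M1' ++ D2 ++ M2 = supports A by rewrite WE -!catA.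
  by move=> /mapP[i _ ->]; apply: (thick_admissible i adm).
have far B' : B' \in E1 ++ E2 -> {in B', forall x, (N <= `|x|)%N}.
  move=> /(nthP [::])[i lti <-].
  have lti2 : (i < 2 * s)%N by move: lti; rewrite size_cat e1 e2 addnn mul2n.
  have ltn : (i < n)%N.
    by apply: leq_trans lti2 (leq_trans _ s11); rewrite leq_mul2r orbT.
  have -> : nth [::] (E1 ++ E2) i = enum_fset (A (Ordinal ltn)).
    by rewrite -(nth_supports A) WE [RHS]nth_cat lti.
  move=> x; apply: (far_admissible adm).
  apply: (@le_trans _ _ (2 * s%:R)); first by rewrite -natrM ler_nat.
  apply: (@le_trans _ _ (delta * m0%:R * s%:R)); first by rewrite ler_wpM2r ?ler0n.
  by rewrite -mulrA ler_wpM2l ?(ltW d0) // -natrM ler_nat.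
have main := @prob_avg_gt R p p0 p12 G Gam a sigma R2 N r s f E1 E2 As D1 M1' D2 M2
  N0 s0 r0 a1 aq G1 Gam1 NGs erefl rs (lexx _) sqs ps.
rewrite sA in main.
have {}main := main ce _ e1 e2 sD1 sM1 sD2 sM2 tk far f0 (mass_le_esum f0 f1)
  (log2_lipschitz_le flip).
apply: (@le_trans _ _ (Gam^-1 ^+ s)); last first.
  rewrite /Gam -expRN -expRM_natl ler_expR mulrN lerN2.
  have : n%:R <= 2 * m0%:R * s%:R :> R by rewrite -!natrM ler_nat.
  move=> le; apply: (@le_trans _ _ (M * (2 * m0%:R * s%:R))).
    by rewrite ler_wpM2l //; lra.
  by rewrite le_eqVlt; apply/orP; left; apply/eqP; ring.
apply: (@prob_supports _ _ _ _ (fun x => exists t,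
   (8 * lo_const p + 1) / (N%:R * Num.sqrt s%:R) < avg p f x t)).
- by rewrite exprn_ge0 // invr_ge0 ltW.
- move=> x [t]; rewrite frand_avg => lt; exists t; apply: le_lt_trans lt.
  have sn0 : 0 < Num.sqrt n%:R :> R by rewrite sqrtr_gt0.
  have ss0 : 0 < Num.sqrt s%:R :> R by rewrite sqrtr_gt0.
  rewrite -!mulrA ler_wpM2l ?addr_ge0 ?mulr_ge0 ?(ltW lo0) //.
  rewrite ler_pdivlMr ?mulr_gt0 // mulrC ler_pdivrMr ?mulr_gt0 //.
  rewrite mulrCA ler_wpM2l ?(ltW N0') // /w0 -sqrtrM ?mulr_ge0 ?(ltW m00) //.
  by rewrite ler_wsqrtr // -!natrM ler_nat.
- rewrite WE; apply: main.
  by rewrite leq_subRL; move: s11; clear; lia.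
Qed.
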